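(* Let $(M,d)$ be a metric space with more than one element and with a distinguished point $0\in M$. Then the Lipschitz-free space $\mathcal F(M)$ is locally almost square if and only if $\mathcal F(M)$ has the Daugavet property.
   Context: All Banach spaces are real. Lipschitz-free space: for a metric space $(M,d)$ with a distinguished point $0\in M$, $\operatorname{Lip}_0(M)$ is the Banach space of all Lipschitz functions $f\colon M\to\mathbb R$ with $f(0)=0$, with norm $\|f\|=\sup\{|f(p)-f(q)|/d(p,q)\colon p,q\in M,\ p\neq q\}$. For $p\in M$ let $\delta_p\in\operatorname{Lip}_0(M)^*$ be given by $\delta_p(f)=f(p)$. The Lipschitz-free space is $\mathcal F(M)=\overline{\operatorname{span}}\{\delta_p\colon p\in M\}\subset\operatorname{Lip}_0(M)^*$, with the norm inherited from $\operatorname{Lip}_0(M)^*$. Locally almost square: a Banach space $X$ with unit sphere $S_X$ is locally almost square if for every $\varepsilon>0$ and every $x\in S_X$ there exists $y\in S_X$ such that $\|x+y\|\le 1+\varepsilon$ and $\|x-y\|\le 1+\varepsilon$. Daugavet property: a Banach space $X$ has the Daugavet property if $\|I+T\|=1+\|T\|$ for every rank-one bounded linear operator $T\colon X\to X$, where $I$ is the identity operator on $X$. *)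

(* Defs.v *)
From HB Require Import structures.
From mathcomp Require Import all_boot all_order all_algebra.
From mathcomp Require Import all_classical all_reals.
From mathcomp Require Import topology normedtype.

Set Implicit Arguments.
Unset Strict Implicit.
Unset Printing Implicit Defensive.

Import Order.TTheory GRing.Theory Num.Theory.
Import numFieldNormedType.Exports.

Local Open Scope classical_set_scope.
Local Open Scope ring_scope.

Section OperatorNorm.
Context {R : realType} {X Y : normedModType R}.

Definition bounded_op (f : X -> Y) : Prop :=
  exists C : R, forall x, `|f x| <= C * `|x|.

(* [sup] is only meaningful for bounded sets: [opnorm f] is used for
   bounded linear [f] only. *)
Definition opnorm (f : X -> Y) : R := sup [set `|f x| | x in [set x | `|x| <= 1]].

Lemma bounded_op_has_sup (f : X -> Y) :
  bounded_op f -> has_sup [set `|f x| | x in [set x | `|x| <= 1]].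
Proof.
move=> [C fC]; split; first by exists `|f 0|; exists 0 => //=; rewrite normr0.
exists `|C| => _ [x /= x1 <-]; apply: le_trans (fC x) _.
rewrite -[leRHS]mulr1; apply: le_trans (ler_norm _) _.
by rewrite normrM normr_id ler_wpM2l.
Qed.

Lemma opnorm_ub (f : X -> Y) x : bounded_op f -> `|x| <= 1 -> `|f x| <= opnorm f.
Proof.
move=> /bounded_op_has_sup[_ ub] x1; apply: ub_le_sup => //.
by exists x.
Qed.

Lemma opnorm_le (f : X -> Y) (c : R) :
  (forall x, `|x| <= 1 -> `|f x| <= c) -> opnorm f <= c.
Proof.
move=> fc; apply: ge_sup.
  by exists `|f 0|; exists 0 => //=; rewrite normr0.
by move=> _ [x /= x1 <-]; exact: fc.
Qed.

Lemma opnorm_ge0 (f : X -> Y) : bounded_op f -> 0 <= opnorm f.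
Proof.
by move=> bf; apply: le_trans (opnorm_ub (x := 0) bf _); rewrite ?normr0.
Qed.

Lemma opnormP (f : X -> Y) x : linear f -> bounded_op f ->
  `|f x| <= opnorm f * `|x|.
Proof.
move=> lf bf.
have f0 : f 0 = 0 by have := lf (-1) 0 0; rewrite !scaleN1r oppr0 addr0 addNr.
have fZ a y : f (a *: y) = a *: f y by have := lf a y 0; rewrite f0 !addr0.
have [->|x0] := eqVneq x 0; first by rewrite f0 !normr0 mulr0.
have nx0 : 0 < `|x| by rewrite normr_gt0.
have := @opnorm_ub f (`|x|^-1 *: x) bf.
rewrite fZ !normrZ normfV normr_id mulVf ?gt_eqF// => /(_ (lexx _)).
by rewrite mulrC ler_pdivrMr.
Qed.

End OperatorNorm.

Section Dual.
Context (R : realType) (X : normedModType R).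

Definition dual_pred : {pred X -> R} :=
  mem [set f : X -> R | linear (f : X -> R^o) /\ bounded_op (f : X -> R^o)].

Record dual := MkDual {
  dual_fun :> X -> R ;
  dual_funP : dual_fun \in dual_pred }.

Lemma dual_linear (f : dual) : linear (f : X -> R^o).
Proof. by case: f => f /= /set_mem[]. Qed.

Lemma dual_bounded (f : dual) : bounded_op (f : X -> R^o).
Proof. by case: f => f /= /set_mem[]. Qed.

Lemma dual_submod_closed : submod_closed dual_pred.
Proof.
split.
  apply: mem_set; split => [a x y|]; first by rewrite scaler0 addr0.
  by exists 0 => x; rewrite normr0 mul0r.
move=> a f g /set_mem[lf [C fC]] /set_mem[lg [D gD]].
apply: mem_set; split => [b x y|].
  rewrite !fctE lf lg /= !scalerDr !scalerA (mulrC a b).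
  by rewrite addrACA.
exists (`|a| * C + D) => x; rewrite mulrDl -mulrA.
apply: le_trans (ler_normD _ _) _; apply: lerD => //.
by rewrite normrZ ler_wpM2l//; exact: fC.
Qed.

HB.instance Definition _ := GRing.isSubmodClosed.Build R (X -> R) dual_pred
  dual_submod_closed.
HB.instance Definition _ := [isSub for dual_fun].
HB.instance Definition _ := [Choice of dual by <:].
HB.instance Definition _ := [SubChoice_isSubLmodule of dual by <:].

Definition dual_norm (f : dual) : R := opnorm (f : X -> R^o).

Lemma dual_normD f g : dual_norm (f + g) <= dual_norm f + dual_norm g.
Proof.
apply: opnorm_le => x x1; apply: le_trans (ler_normD _ _) _.
by apply: lerD; apply: opnorm_ub => //; exact: dual_bounded.
Qed.

Lemma dual_normZ a f : dual_norm (a *: f) = `|a| * dual_norm f.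
Proof.
have le b h : dual_norm (b *: h) <= `|b| * dual_norm h.
  apply: opnorm_le => x x1.
  change (`|b * h x| <= `|b| * dual_norm h); rewrite normrM ler_wpM2l//.
  exact: opnorm_ub (dual_bounded h) x1.
apply/eqP; rewrite eq_le le /=.
have [->|a0] := eqVneq a 0.
  by rewrite normr0 mul0r; apply: opnorm_ge0; exact: dual_bounded.
rewrite -ler_pdivlMl ?normr_gt0// -normfV.
by have := le a^-1 (a *: f); rewrite scalerA mulVf// scale1r.
Qed.

Lemma dual_norm0_eq0 f : dual_norm f = 0 -> f = 0.
Proof.
move=> f0; apply: val_inj; apply/funext => x /=.
have := opnormP x (@dual_linear f) (@dual_bounded f).
rewrite -/(dual_norm f) f0 mul0r normr_le0 => /eqP.
exact.
Qed.

HB.instance Definition _ := Lmodule_isNormed.Build R dual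
  dual_normD dual_normZ dual_norm0_eq0.

End Dual.

Section Span.
Context {R : realType} {X : normedModType R}.

Definition lin_span (A : set X) : set X :=
  [set x | exists (n : nat) (c : 'I_n -> R) (v : 'I_n -> X),
     (forall i, A (v i)) /\ x = \sum_(i < n) c i *: v i].

Lemma lin_span_submod (A : set X) (a : R) x y :
  lin_span A x -> lin_span A y -> lin_span A (a *: x + y).
Proof.
move=> [n [c [v [vA ->]]]] [m [d [w [wA ->]]]].
exists (n + m)%N.
exists (fun i => match fintype.split i with inl j => a * c j | inr j => d j end).
exists (fun i => match fintype.split i with inl j => v j | inr j => w j end).
split; first by move=> i; case: (fintype.split i).
rewrite big_split_ord /= scaler_sumr; congr (_ + _); apply: eq_bigr => i _.
  by rewrite -[lshift _ _]/(unsplit (inl i)) unsplitK scalerA.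
by rewrite -[rshift _ _]/(unsplit (inr i)) unsplitK.
Qed.

Lemma closure_submod (A : set X) (a : R) x y :
  (forall u v, A u -> A v -> A (a *: u + v)) ->
  closure A x -> closure A y -> closure A (a *: x + y).
Proof.
move=> AS.
have clP z : closure A z -> forall e, 0 < e -> exists2 u, A u & `|z - u| < e.
  move=> + e e0 => /(_ (ball z e) (nbhsx_ballx _ _ e0))[u [Au zu]].
  by exists u => //; move: zu; rewrite -ball_normE.
move=> /clP xA /clP yA B /nbhs_ballP[e /= e0 eB].
have d0 : 0 < e / 2 / (`|a| + 1) by rewrite !divr_gt0// ltr_pwDr.
have [u Au xu] := xA _ d0.
have [v Av yv] := yA _ (divr_gt0 e0 (ltr0Sn _ 1)).
exists (a *: u + v); split; first exact: AS.
apply: eB; rewrite -ball_normE /ball_/=.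
rewrite opprD addrACA -scalerBr; apply: le_lt_trans (ler_normD _ _) _.
rewrite (splitr e); apply: ler_ltD => //; rewrite normrZ.
move: xu; rewrite ltr_pdivlMr ?ltr_pwDr// => /ltW; apply: le_trans.
by rewrite mulrC ler_wpM2l// lerDl.
Qed.

End Span.

Section Lip0.
Context (R : realType) (M : metricType R) (x0 : M).

Definition lip0_pred : {pred M -> R} :=
  mem [set f : M -> R | f x0 = 0 /\
    exists C : R, forall p q, `|f p - f q| <= C * mdist p q].

Record Lip0 := MkLip0 {
  lip0_fun :> M -> R ;
  lip0_funP : lip0_fun \in lip0_pred }.

Lemma lip0_submod_closed : submod_closed lip0_pred.
Proof.
split.
  apply: mem_set; split => //.
  by exists 0 => p q; rewrite subrr normr0 mul0r.
move=> a f g /set_mem[f0 [C fC]] /set_mem[g0 [D gD]].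
apply: mem_set; split; first by rewrite !fctE f0 g0 scaler0 addr0.
exists (`|a| * C + D) => p q; rewrite mulrDl -mulrA.
rewrite !fctE opprD addrACA -scalerBr.
apply: le_trans (ler_normD _ _) _; apply: lerD => //.
by rewrite normrZ ler_wpM2l.
Qed.

HB.instance Definition _ := GRing.isSubmodClosed.Build R (M -> R) lip0_pred
  lip0_submod_closed.
HB.instance Definition _ := [isSub for lip0_fun].
HB.instance Definition _ := [Choice of Lip0 by <:].
HB.instance Definition _ := [SubChoice_isSubLmodule of Lip0 by <:].

Definition slopes (f : M -> R) : set R :=
  [set s | exists p q, p != q /\ s = `|f p - f q| / mdist p q].

(* If [M] is a singleton, then [slopes f] is empty and its [sup] is 0. *)
Definition lip0_norm (f : Lip0) : R := sup (slopes f).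

Lemma lip0_norm_ub (f : Lip0) : has_ubound (slopes f).
Proof.
case: f => f /= /set_mem[_ [C fC]]; exists C => _ [p [q [pq ->]]].
by rewrite ler_pdivrMr ?mdist_gt0.
Qed.

Lemma lip0_norm_ge0 f : 0 <= lip0_norm f.
Proof.
rewrite /lip0_norm; have [->|/set0P[s sf]] := eqVneq (slopes f) set0.
  by rewrite sup0.
apply: le_trans (ub_le_sup (lip0_norm_ub f) sf).
by case: sf => p [q [_ ->]]; rewrite divr_ge0 ?mdist_ge0.
Qed.

Lemma lip0_normP (f : Lip0) p q : `|f p - f q| <= lip0_norm f * mdist p q.
Proof.
have [->|pq] := eqVneq p q; first by rewrite subrr normr0 mdistxx mulr0.
rewrite -ler_pdivrMr ?mdist_gt0// /lip0_norm; apply: (ub_le_sup (lip0_norm_ub f)).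
by exists p, q.
Qed.

Lemma lip0_norm_le (f : Lip0) (c : R) : 0 <= c ->
  (forall p q, `|f p - f q| <= c * mdist p q) -> lip0_norm f <= c.
Proof.
move=> c0 fc; rewrite /lip0_norm.
have [->|/set0P ne] := eqVneq (slopes f) set0; first by rewrite sup0.
apply: ge_sup => // _ [p [q [pq ->]]].
by rewrite ler_pdivrMr ?mdist_gt0.
Qed.

Lemma lip0_normD f g : lip0_norm (f + g) <= lip0_norm f + lip0_norm g.
Proof.
apply: lip0_norm_le => [|p q]; first by rewrite addr_ge0 ?lip0_norm_ge0.
rewrite -[(f + g) p]/(f p + g p) -[(f + g) q]/(f q + g q).
rewrite opprD addrACA mulrDl; apply: le_trans (ler_normD _ _) _.
by apply: lerD; exact: lip0_normP.
Qed.

Lemma lip0_normZ a f : lip0_norm (a *: f) = `|a| * lip0_norm f.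
Proof.
have le b h : lip0_norm (b *: h) <= `|b| * lip0_norm h.
  apply: lip0_norm_le => [|p q]; first by rewrite mulr_ge0 ?lip0_norm_ge0.
  rewrite -[(b *: h) p]/(b * h p) -[(b *: h) q]/(b * h q).
  by rewrite -mulrBr normrM -mulrA ler_wpM2l// lip0_normP.
apply/eqP; rewrite eq_le le /=.
have [->|a0] := eqVneq a 0; first by rewrite normr0 mul0r lip0_norm_ge0.
rewrite -ler_pdivlMl ?normr_gt0// -normfV.
by have := le a^-1 (a *: f); rewrite scalerA mulVf// scale1r.
Qed.

Lemma lip0_at0 (f : Lip0) : f x0 = 0.
Proof. by case: f => f /= /set_mem[]. Qed.

Lemma lip0_norm0_eq0 f : lip0_norm f = 0 -> f = 0.
Proof.
move=> f0; apply: val_inj; apply/funext => p /=.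
have := lip0_normP f p x0.
by rewrite f0 mul0r lip0_at0 subr0 normr_le0 => /eqP.
Qed.

HB.instance Definition _ := Lmodule_isNormed.Build R Lip0
  lip0_normD lip0_normZ lip0_norm0_eq0.

End Lip0.

Section LipschitzFree.
Context (R : realType) (M : metricType R) (x0 : M).

Lemma delta_subproof (p : M) : (fun f : Lip0 x0 => f p) \in @dual_pred R (Lip0 x0).
Proof.
apply: mem_set; split => //; exists (mdist p x0) => f.
by have := lip0_normP f p x0; rewrite lip0_at0 subr0 mulrC.
Qed.

Definition delta (p : M) : dual (Lip0 x0) := MkDual (delta_subproof p).

Definition lipfree_pred : {pred dual (Lip0 x0)} :=
  mem (closure (lin_span (range delta))).

Record lipfree := MkLipfree {
  lipfree_val :> dual (Lip0 x0) ;
  lipfree_valP : lipfree_val \in lipfree_pred }.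

Lemma lipfree_submod_closed : submod_closed lipfree_pred.
Proof.
split.
  apply: mem_set; apply: subset_closure.
  by exists 0, (fun=> 0), (fun=> 0); split=> [[]//|]; rewrite big_ord0.
move=> a f g /set_mem fA /set_mem gA; apply: mem_set.
by apply: closure_submod => // u v; exact: lin_span_submod.
Qed.

HB.instance Definition _ := GRing.isSubmodClosed.Build R (dual (Lip0 x0))
  lipfree_pred lipfree_submod_closed.
HB.instance Definition _ := [isSub for lipfree_val].
HB.instance Definition _ := [Choice of lipfree by <:].
HB.instance Definition _ := [SubChoice_isSubLmodule of lipfree by <:].

Definition lipfree_norm (m : lipfree) : R := `|lipfree_val m|.

Lemma lipfree_normD m n : lipfree_norm (m + n) <= lipfree_norm m + lipfree_norm n.
Proof. exact: ler_normD. Qed.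

Lemma lipfree_normZ a m : lipfree_norm (a *: m) = `|a| * lipfree_norm m.
Proof. exact: normrZ. Qed.

Lemma lipfree_norm0_eq0 m : lipfree_norm m = 0 -> m = 0.
Proof. by move=> /normr0_eq0 m0; exact: val_inj. Qed.

HB.instance Definition _ := Lmodule_isNormed.Build R lipfree
  lipfree_normD lipfree_normZ lipfree_norm0_eq0.

End LipschitzFree.

Section GeometricProperties.
Context {R : realType} (X : normedModType R).

Definition locally_almost_square : Prop :=
  forall eps : R, 0 < eps -> forall x : X, `|x| = 1 ->
  exists y : X, [/\ `|y| = 1, `|x + y| <= 1 + eps & `|x - y| <= 1 + eps].

Definition rank_one (T : {linear X -> X}) : Prop :=
  exists2 e : X, e != 0 & range T = [set a *: e | a in [set: R]].

Definition Daugavet_property : Prop :=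
  forall T : {linear X -> X}, bounded_op T -> rank_one T ->
  opnorm (idfun \+ T) = 1 + opnorm T.

End GeometricProperties.

(* Main.v *)
From HB Require Import structures.
Require Import Defs.
From mathcomp Require Import all_boot all_order all_algebra.
From mathcomp Require Import all_classical all_reals.
From mathcomp Require Import topology normedtype.
From mathcomp Require Import ring lra.

Set Implicit Arguments.
Unset Strict Implicit.
Unset Printing Implicit Defensive.

Import Order.TTheory GRing.Theory Num.Theory.
Import numFieldNormedType.Exports.

Local Open Scope classical_set_scope.
Local Open Scope ring_scope.

(** Both properties are equivalent to the existence of approximate midpoints in
  [M].

  Either property of the free space forces the following on [M]: for every
  1-Lipschitz [f] that is almost attained at a pair of points there is a
  1-Lipschitz [g] such that [f] is almost attained at a pair where [g] rises as
  steeply as possible, and at a pair where [g] falls as steeply as possible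
  (take [g] norming the vector [y], respectively [y - y(f) m_pq]). If [p] and
  [q] had no approximate midpoint, the balls around them of radius slightly
  more than [d(p,q)/2] would be disjoint, and from the two tents on these balls
  one could build [f] whose almost attaining pairs all cluster at one pair; no
  [g] can both rise and fall there.

  Conversely, approximate midpoints make local Lipschitz constants global.
  For the Daugavet property, [f] is then almost attained at arbitrarily close
  pairs [u], [v] away from any finite set, and a bump at [u] turns a function
  norming [e] into one that is also maximally steep at [u], [v].
  For local almost squareness, the set of all [(z, c)] such that some [w]
  satisfies [|z + w|], [|z - w| <= c] up to terms that are small at the given
  [x] contains [(delta_p - delta_q, d(p,q))] for [p], [q] close ([w] is a
  multiple of [z], with the slope of a fine zigzag of [f] as factor). By the
  Hahn-Banach theorem and the passage from local to global Lipschitz constants,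
  the gauge of this convex cone is at most the norm. *)

(** * The Hahn-Banach theorem for sublinear functionals *)

Section HahnBanach.
Context {R : realType} {V : lmodType R}.
Implicit Types (p q : V -> R) (x y z : V).

Definition sublinear q : Prop :=
  (forall x y, q (x + y) <= q x + q y) /\
  (forall a x, 0 <= a -> q (a *: x) <= a * q x).

(** The pairs [(z, c)] with [S z c] form a convex cone, up to lowering [c], and the infimum is its
    lower boundary. Perturbations, infima of chains and the gauge of [square_cone] are all obtained
    in this way. *)
Lemma inf_sublinear (S : V -> set R) :
  (forall z, S z !=set0) -> (forall z, has_lbound (S z)) ->
  (forall x y a b, S x a -> S y b -> exists2 c, S (x + y) c & c <= a + b) ->
  (forall x a t, 0 <= t -> S x a -> exists2 c, S (t *: x) c & c <= t * a) ->
  sublinear (fun z => inf (S z)).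
Proof.
move=> S0 Sb SD SZ; have hi z : has_inf (S z) by split.
split => [x y|t x t0].
  apply/ler_addgt0Pr => e e0; have e2 : 0 < e / 2 by rewrite divr_gt0.
  have [a Sa ae] := inf_adherent e2 (hi x).
  have [b Sb' be] := inf_adherent e2 (hi y).
  have [c Sc cab] := SD _ _ _ _ Sa Sb'.
  have := ge_inf (Sb _) Sc; lra.
apply/ler_addgt0Pr => e e0; have e2 : 0 < e / (t + 1) by rewrite divr_gt0// ltr_wpDl.
have [a Sa ae] := inf_adherent e2 (hi x).
have [c Sc ca] := SZ _ _ _ t0 Sa.
apply: le_trans (ge_inf (Sb _) Sc) _; apply: (le_trans ca).
have : t * a <= t * (inf (S x) + e / (t + 1)) by rewrite ler_wpM2l// ltW.
move=> /le_trans; apply; rewrite mulrDr lerD2l mulrA ler_pdivrMr ?ltr_wpDl//.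
nra.
Qed.

Lemma sublinear0 q : sublinear q -> q 0 = 0.
Proof.
move=> [qD qZ]; apply/eqP; rewrite eq_le; apply/andP; split.
  by have := qZ 0 0 (lexx _); rewrite scale0r mul0r.
by have := qD 0 0; rewrite addr0 -{1}[q 0]addr0 lerD2l.
Qed.

Lemma sublinear_oppl q z : sublinear q -> - q (- z) <= q z.
Proof.
move=> hq; have := hq.1 z (- z); rewrite subrr sublinear0//; lra.
Qed.

Lemma sublinearZ q a x : sublinear q -> 0 <= a -> q (a *: x) = a * q x.
Proof.
move=> hq; rewrite le_eqVlt => /predU1P[<-|a0].
  by rewrite scale0r mul0r sublinear0.
apply/eqP; rewrite eq_le hq.2 ?(ltW a0)// andTb.
rewrite -(ler_pdivlMl _ _ a0).
have ai : 0 <= a^-1 by rewrite invr_ge0 ltW.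
by have := hq.2 _ (a *: x) ai; rewrite scalerA mulVf ?scale1r// gt_eqF.
Qed.

(** For sublinear [q], this is the largest sublinear functional below [q] whose value at [- y] is at
    most [- q y]. *)
Definition perturbed q y z := inf [set q (z + t *: y) - t * q y | t in [set t | 0 <= t]].

Lemma perturbed_lb q y z : sublinear q ->
  lbound [set q (z + t *: y) - t * q y | t in [set t | 0 <= t]] (- q (- z)).
Proof.
move=> hq _ [t /= t0 <-]; have := sublinearZ y hq t0.
have := hq.1 (z + t *: y) (- z); rewrite addrAC subrr add0r; lra.
Qed.

Lemma perturbed_le q y z t : sublinear q -> 0 <= t ->
  perturbed q y z <= q (z + t *: y) - t * q y.
Proof.
move=> hq t0; apply: ge_inf; last by exists t.
by exists (- q (- z)); exact: perturbed_lb.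
Qed.

Lemma perturbed_sublinear q y : sublinear q -> sublinear (perturbed q y).
Proof.
move=> hq; apply: inf_sublinear.
- by move=> z; exists (q (z + 0 *: y) - 0 * q y); exists 0 => /=.
- by move=> z; exists (- q (- z)); exact: perturbed_lb.
- move=> u v _ _ [s /= s0 <-] [t /= t0 <-].
  exists (q (u + v + (s + t) *: y) - (s + t) * q y).
    by exists (s + t) => //=; rewrite addr_ge0.
  have := hq.1 (u + s *: y) (v + t *: y).
  rewrite scalerDl addrACA; lra.
move=> u _ t t0 [s /= s0 <-].
exists (q (t *: u + (t * s) *: y) - t * s * q y).
  by exists (t * s) => //=; rewrite mulr_ge0.
by rewrite -scalerA -scalerDr sublinearZ// mulrBr mulrA.
Qed.

(** The bound [- p (- z) <= - q (- z) <= q z] keeps the infimum finite. For subadditivity, of two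
    members of the chain the smaller one serves at both points. *)
Lemma chain_sublinear p (A : set (V -> R)) : A !=set0 ->
  (forall q, A q -> sublinear q /\ forall z, q z <= p z) ->
  (forall q q', A q -> A q' ->
     (forall z, q z <= q' z) \/ (forall z, q' z <= q z)) ->
  sublinear (fun z => inf [set q z | q in A]) /\
  (forall q z, A q -> inf [set q z | q in A] <= q z).
Proof.
move=> [q0 Aq0] Ap Ach.
have lb z : has_lbound [set q z | q in A].
  exists (- p (- z)) => _ [q Aq <-]; have [hq hp] := Ap _ Aq.
  have := sublinear_oppl z hq; have := hp (- z); lra.
split; last by move=> q z Aq; apply: ge_inf => //; exists q.
apply: inf_sublinear => //.
- by move=> z; exists (q0 z); exists q0.
- move=> x y _ _ [q Aq <-] [q' Aq' <-].
  have [qq|qq] := Ach _ _ Aq Aq'.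
    exists (q (x + y)); first by exists q.
    by apply: le_trans ((Ap _ Aq).1.1 _ _) _; rewrite lerD2l.
  exists (q' (x + y)); first by exists q'.
  by apply: le_trans ((Ap _ Aq').1.1 _ _) _; rewrite lerD2r.
move=> x _ t t0 [q Aq <-]; exists (q (t *: x)); first by exists q.
by rewrite sublinearZ//; exact: (Ap _ Aq).1.
Qed.

Lemma minimal_sublinear p : sublinear p ->
  exists2 q, sublinear q /\ (forall z, q z <= p z) &
    forall q', sublinear q' -> (forall z, q' z <= q z) -> q' = q.
Proof.
move=> hp.
pose T := {q : V -> R | sublinear q /\ forall z, q z <= p z}.
(* The order is reversed, so that a maximal element in Zorn's lemma is a minimal functional. *)
pose le (s t : T) := `[< forall z, sval t z <= sval s z >].
have sval_inj' (s t : T) : sval s = sval t -> s = t.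
  by case: s t => [s hs] [t ht] /= st; subst t; congr exist; exact: Prop_irrelevance.
have [| | | |[q [hq qp]] qmax] := @Zorn T le.
- by move=> t; apply/asboolP.
- move=> r s t /asboolP rs /asboolP st; apply/asboolP => z.
  exact: le_trans (st z) (rs z).
- move=> s t /asboolP st /asboolP ts; apply: sval_inj'; apply/funext => z.
  by apply/eqP; rewrite eq_le ts st.
- move=> A Ach.
  have [[a0 Aa0]|A0] := pselect (A !=set0); last first.
    have hpp : sublinear p /\ forall z, p z <= p z by [].
    by exists (exist _ p hpp) => s As; case: A0; exists s.
  pose B := [set sval s | s in A].
  have [| | |inf_s inf_le] := @chain_sublinear p B.
  + by exists (sval a0), a0.
  + by move=> _ [s As <-]; exact: svalP s.
  + move=> _ _ [s As <-] [t At <-].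
    by have [/asboolP|/asboolP] := Ach s t As At; [right|left].
  have h : sublinear (fun z => inf [set q z | q in B]) /\
      forall z, inf [set q z | q in B] <= p z.
    split => // z; apply: (@le_trans _ _ (sval a0 z)); first by apply: inf_le; exists a0.
    exact: (svalP a0).2.
  exists (exist _ (fun z => inf [set q z | q in B]) h) => s As; apply/asboolP => z /=.
  by apply: inf_le; exists s.
exists q => // q' hq' q'q.
have h : sublinear q' /\ forall z, q' z <= p z.
  by split => // z; exact: le_trans (q'q z) (qp z).
suff /(congr1 sval) : exist _ q' h = exist _ q (conj hq qp) :> T by [].
by apply: qmax; apply/asboolP.
Qed.

(* Minimality applied to [perturbed q y], whose value at [- y] is at most
   [- q y], shows that a minimal [q] is odd. *)
Theorem hahn_banach p x : sublinear p ->
  exists l : V -> R, [/\ forall a y z, l (a *: y + z) = a * l y + l z,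
    forall z, l z <= p z & l x = p x].
Proof.
move=> hp.
have pert_opp q y : sublinear q -> perturbed q y (- y) <= - q y.
  move=> hq; have := perturbed_le y (- y) hq ler01.
  by rewrite scale1r addNr sublinear0// mul1r add0r.
have pert_le q y z : sublinear q -> perturbed q y z <= q z.
  move=> hq; have := perturbed_le y z hq (lexx 0).
  by rewrite scale0r addr0 mul0r subr0.
(* Minimality is taken below [perturbed p x] and not just below [p]: this gives [l (- x) <= - p x],
   hence [l x = p x] once [l] is odd. *)
have [l [hl lp] lmin] := minimal_sublinear (perturbed_sublinear x hp).
have lN y : l (- y) = - l y.
  apply/eqP; rewrite eq_le; apply/andP; split; last first.
    by rewrite lerNl; exact: sublinear_oppl.
  rewrite -{1}(lmin _ (perturbed_sublinear y hl)); first exact: pert_opp.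
  by move=> z; exact: pert_le.
have lZ a y : l (a *: y) = a * l y.
  have [a0|a0] := leP 0 a; first exact: sublinearZ.
  rewrite -[a]opprK scaleNr lN sublinearZ ?mulNr//; lra.
have lD y z : l (y + z) = l y + l z.
  apply/eqP; rewrite eq_le hl.1/=.
  have := hl.1 (- y) (- z); rewrite -opprD !lN; lra.
exists l; split => [a y z|z|].
- by rewrite lD lZ.
- exact: le_trans (lp z) (pert_le _ _ _ hp).
apply/eqP; rewrite eq_le (le_trans (lp x) (pert_le _ _ _ hp))/=.
rewrite -lerN2 -lN; exact: le_trans (lp _) (pert_opp _ _ hp).
Qed.

End HahnBanach.

(** * Evaluations, norming functions and the duality between the free space and [Lip0] *)

Section LipschitzFreeTheory.
Context {R : realType} {M : metricType R} {x0 : M}.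
Implicit Types (f g : Lip0 x0) (x y : lipfree x0) (p q : M).

Lemma lip0_ler f p q : f p - f q <= `|f| * mdist p q.
Proof. exact: le_trans (ler_norm _) (lip0_normP f p q). Qed.

Lemma lip0_ler1 f p q : `|f| <= 1 -> f p - f q <= mdist p q.
Proof.
move=> f1; apply: (le_trans (lip0_ler f p q)).
by rewrite -[leRHS]mul1r ler_wpM2r// mdist_ge0.
Qed.

Lemma lip0_norm_le1 f c : 0 <= c ->
  (forall p q, f p - f q <= c * mdist p q) -> `|f| <= c.
Proof.
move=> c0 fc; apply: lip0_norm_le => // p q.
by rewrite ler_norml fc andbT lerNl opprB metric_sym fc.
Qed.

Lemma lip0_steep f c : 0 <= c -> c < `|f| ->
  exists p q, p != q /\ c * mdist p q < f p - f q.
Proof.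
move=> c0 cf; apply: contrapT => H; move: cf; apply/negP; rewrite -leNgt.
apply: lip0_norm_le1 => // p q; rewrite leNgt; apply/negP => pq; apply: H.
exists p, q; split => //; apply: contraTneq pq => ->.
by rewrite mdistxx mulr0 subrr ltxx.
Qed.

Lemma lip0_of_fun (a : M -> R) c : 0 <= c ->
  (forall p q, a p - a q <= c * mdist p q) ->
  exists2 f : Lip0 x0, `|f| <= c & forall p, f p = a p - a x0.
Proof.
move=> c0 ac.
have aP : (fun p => a p - a x0) \in @lip0_pred R M x0.
  apply: mem_set; split; first by rewrite subrr.
  exists c => p q; rewrite opprB addrA subrK.
  by rewrite ler_norml ac andbT lerNl opprB metric_sym ac.
exists (MkLip0 aP) => //; apply: lip0_norm_le1 => // p q.
by rewrite /= opprB addrA subrK.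
Qed.

Lemma lfDl x y f : (x + y) f = x f + y f. Proof. by []. Qed.
Lemma lfNl x f : (- x) f = - x f. Proof. by []. Qed.
Lemma lfBl x y f : (x - y) f = x f - y f. Proof. by []. Qed.
Lemma lfZl a x f : (a *: x) f = a * x f. Proof. by []. Qed.

Lemma lfZDr a x f g : x (a *: f + g) = a * x f + x g.
Proof. exact: dual_linear. Qed.

Lemma lfDr x f g : x (f + g) = x f + x g.
Proof. by rewrite -[f]scale1r lfZDr mul1r scale1r. Qed.

Lemma lf0r x : x 0 = 0.
Proof. by have := lfDr x 0 0; rewrite addr0 -{1}[x 0]addr0 => /addrI. Qed.

Lemma lfZr a x f : x (a *: f) = a * x f.
Proof. by rewrite -[a *: f]addr0 lfZDr lf0r addr0. Qed.

Lemma lfNr x f : x (- f) = - x f.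
Proof. by rewrite -scaleN1r lfZr mulN1r. Qed.

Lemma lfBr x f g : x (f - g) = x f - x g.
Proof. by rewrite lfDr lfNr. Qed.

Lemma lf_normr_le x f : `|x f| <= `|x| * `|f|.
Proof. exact: opnormP (@dual_linear _ _ x) (@dual_bounded _ _ x). Qed.

Lemma lf_le x f : x f <= `|x| * `|f|.
Proof. exact: le_trans (ler_norm _) (lf_normr_le x f). Qed.

Lemma lf_le1 x f : `|f| <= 1 -> x f <= `|x|.
Proof.
by move=> f1; apply: (le_trans (lf_le x f)); rewrite -[leRHS]mulr1 ler_wpM2l.
Qed.

Lemma lipfree_norm_le x c : (forall f, `|f| <= 1 -> x f <= c) -> `|x| <= c.
Proof.
move=> xc; apply: opnorm_le => f f1.
by rewrite ler_norml xc// andbT lerNl -lfNr xc// normrN.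
Qed.

Lemma lipfree_norming x c : c < `|x| -> exists2 f, `|f| <= 1 & c < x f.
Proof.
move=> cx; apply: contrapT => H; move: cx; apply/negP; rewrite -leNgt.
apply: lipfree_norm_le => f f1; rewrite leNgt; apply/negP => ?.
by apply: H; exists f.
Qed.

Lemma dirac_subproof p : delta x0 p \in @lipfree_pred R M x0.
Proof.
apply: mem_set; apply: subset_closure.
exists 1%N, (fun=> 1), (fun=> delta x0 p); split; first by move=> _; exists p.
by rewrite big_ord1 scale1r.
Qed.

Definition dirac p : lipfree x0 := MkLipfree (dirac_subproof p).

Lemma diracE p f : dirac p f = f p. Proof. by []. Qed.

Lemma dirac_base : dirac x0 = 0.
Proof.
by apply/val_inj/val_inj/funext => f /=; rewrite (lip0_at0 f).
Qed.

Lemma dirac_dist p q : `|dirac p - dirac q| = mdist p q.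
Proof.
apply/eqP; rewrite eq_le; apply/andP; split.
  by apply: lipfree_norm_le => f f1; rewrite lfBl; exact: lip0_ler1.
(* The distance to [q], shifted to vanish at [x0], attains the norm. *)
have [|f f1 fE] := @lip0_of_fun (mdist q) 1 ler01.
  move=> a b; rewrite mul1r lerBlDl addrC.
  by rewrite (le_trans (metric_triangle _ b _))// addrC (metric_sym b) lerD2r.
have := lf_le1 (dirac p - dirac q) f1.
by rewrite lfBl !diracE !fE mdistxx opprB addrA subrK subr0 metric_sym.
Qed.

Lemma dirac_dense x e : 0 < e -> exists (n : nat) (c : 'I_n -> R) (p : 'I_n -> M),
  `|x - \sum_(i < n) c i *: dirac (p i)| < e.
Proof.
move=> e0; have /set_mem xc := lipfree_valP x.
have [u []] := xc (ball (lipfree_val x) e) (nbhsx_ballx _ _ e0).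
move=> [n [c [v [vr ->]]]]; rewrite -ball_normE /ball_/= => xe.
have [p pv] := @choice _ _ (fun i p => delta x0 p = v i)
  (fun i => let: ex_intro2 p _ h := vr i in ex_intro _ p h).
exists n, c, p; suff -> : `|x - \sum_(i < n) c i *: dirac (p i)| =
  `|lipfree_val x - \sum_(i < n) c i *: v i| by [].
rewrite -[LHS]/`|lipfree_val x - lipfree_val _|; congr `|_ - _|.
elim/big_ind2 : _ => // [? ? ? ? <- <-|i _] //.
by rewrite -pv.
Qed.

Lemma lf_sum_dirac n (c : 'I_n -> R) (p : 'I_n -> M) f :
  (\sum_(i < n) c i *: dirac (p i)) f = \sum_(i < n) c i * f (p i).
Proof.
elim/big_ind2 : _ => // x a y b xa yb; by rewrite lfDl xa yb.
Qed.

(** Both sides are linear and bounded in [x] and agree on the evaluations, whose span is dense. *)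
Lemma rank_one_lipfree (E : normedModType R) (T : lipfree x0 -> E) (e : E) f :
  linear T -> bounded_op T -> (forall p, T (dirac p) = f p *: e) ->
  forall x, T x = x f *: e.
Proof.
move=> lT [C TC] Td x.
have TD y z : T (y + z) = T y + T z by have := lT 1 y z; rewrite !scale1r.
have T0 : T 0 = 0 by have := TD 0 0; rewrite addr0 -{1}[T 0]addr0 => /addrI.
have TZ a y : T (a *: y) = a *: T y by have := lT a y 0; rewrite T0 !addr0.
apply/eqP; rewrite -subr_eq0 -normr_le0; apply/ler_addgt0Pr => eps eps0.
rewrite add0r; pose K := `|C| + `|f| * `|e| + 1.
have K0 : 0 < K by rewrite ltr_wpDl// addr_ge0// mulr_ge0.
have [n [c [p xe]]] := dirac_dense x (divr_gt0 eps0 K0).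
set s := \sum_(i < n) _ in xe.
have Ts : T s = s f *: e.
  rewrite /s lf_sum_dirac scaler_suml.
  have -> : T (\sum_(i < n) c i *: dirac (p i)) = \sum_(i < n) T (c i *: dirac (p i)).
    by elim/big_ind2 : _ => // ? ? ? ? <- <-.
  by apply: eq_bigr => i _; apply: (etrans (TZ _ _)); rewrite Td scalerA.
have -> : T x - x f *: e = T (x - s) - (x - s) f *: e.
  have -> : T (x - s) = T x - T s.
    by rewrite -[- s]scaleN1r TD; congr (_ + _); apply: (etrans (TZ _ _)); rewrite scaleN1r.
  by rewrite lfBl scalerBl -Ts opprB addrA subrK.
rewrite ltr_pdivlMr// in xe; apply: le_trans (ltW xe).
apply: le_trans (ler_normB _ _) _.
have h1 : `|T (x - s)| <= `|C| * `|x - s|.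
  by apply: le_trans (TC _) _; rewrite ler_wpM2r// ler_norm.
have h2 : `|(x - s) f *: e| <= `|x - s| * (`|f| * `|e|).
  by rewrite normrZ mulrA ler_wpM2r// lf_normr_le.
rewrite /K; have := normr_ge0 (x - s); nra.
Qed.

(** The dual of the free space is [Lip0], with [f] the values of [l] at the evaluations. The
    constant [C] provides continuity, while the sharp norm bound [c] is read off from differences of
    two evaluations. *)
Lemma lipfree_functional (l : lipfree x0 -> R) (c C : R) :
  0 <= c -> (forall a x y, l (a *: x + y) = a * l x + l y) ->
  (forall x, `|l x| <= C * `|x|) ->
  (forall p q, l (dirac p) - l (dirac q) <= c * mdist p q) ->
  exists2 f : Lip0 x0, `|f| <= c & forall x, l x = x f.
Proof.
move=> c0 ll lC lc.
have [f f1 fE] := @lip0_of_fun (l \o dirac) c c0 lc.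
have l0 : l 0 = 0.
  by have := ll 1 0 0; rewrite scale1r addr0 mul1r -{1}[l 0]addr0 => /addrI.
exists f => // x.
have := @rank_one_lipfree R^o (l : lipfree x0 -> R^o) 1 f ll _ _ x.
rewrite /GRing.scale/= mulr1; apply; first by exists C.
by move=> p; rewrite fE /= dirac_base l0 subr0 /GRing.scale/= mulr1.
Qed.

End LipschitzFreeTheory.
Arguments dirac {R M} x0 p.

(** * Approximate midpoints, local Lipschitz constants and zigzags *)

Section ApproxMidpoints.
Context {R : realType}.

Definition approx_midpoints (M : metricType R) : Prop :=
  forall (p q : M) (e : R), 0 < e -> exists z : M,
    mdist p z <= mdist p q / 2 + e /\ mdist z q <= mdist p q / 2 + e.

(** Splitting a pair at an approximate midpoint about halves its distance, so the range of validity
    of the estimate can grow by [mu / 2] at each step of an induction; the midpoint error [k] costs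
    [2 c k <= e]. *)
Lemma lipschitz_of_local (M : metricType R) (a : M -> R) (c mu : R) :
  approx_midpoints M -> 0 <= c -> 0 < mu ->
  (forall p q, mdist p q <= mu -> a p - a q <= c * mdist p q) ->
  forall p q, a p - a q <= c * mdist p q.
Proof.
move=> mid c0 mu0 loc.
have step n : forall p q, mdist p q <= (1 + n%:R / 2) * mu ->
    a p - a q <= c * mdist p q.
  elim: n => [|n IH] p q; first by rewrite mul0r addr0 mul1r; exact: loc.
  move=> pq; apply/ler_addgt0Pr => e e0.
  pose k := Num.min (mu / 4) (e / (2 * (c + 1))).
  have c1 : 0 < 2 * (c + 1) by lra.
  have k0 : 0 < k by rewrite lt_min !divr_gt0.
  have [z [pz zq]] := mid p q k k0.
  have k1 : k <= mu / 4 by rewrite ge_min lexx.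
  have k2 : k * (2 * (c + 1)) <= e by rewrite -ler_pdivlMr// ge_min lexx orbT.
  rewrite -natr1 in pq.
  have n0 : (0 : R) <= n%:R by [].
  have hp : mdist p z <= (1 + n%:R / 2) * mu by nra.
  have hq : mdist z q <= (1 + n%:R / 2) * mu by nra.
  have := IH _ _ hp; have := IH _ _ hq; nra.
move=> p q; have [n pqn] : exists n : nat, mdist p q / mu * 2 <= n%:R.
  exists (Num.truncn (mdist p q / mu * 2)).+1.
  by rewrite ltW// truncnS_gt.
apply: (step n); move: pqn; rewrite -ler_pdivlMr// ler_pdivrMr// => pqn.
nra.
Qed.

(* [phi] is the distance to [2 h Z]; [psi] climbs with slope [1] by [mu] just
   after each multiple of [h] and is constant elsewhere, so that its increments
   account for those of [phi] at the kinks. *)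
Lemma zigzag (h mu : R) : 0 < mu -> 2 * mu <= h ->
  exists phi psi : R -> R, [/\ phi 0 = 0, psi 0 = 0,
    forall t, `|phi t| <= h, forall t, `|psi t| <= mu / h * `|t| + 2 * mu &
    forall s t, t <= s -> s - t <= mu ->
    [/\ `|phi s - phi t| <= s - t, 0 <= psi s - psi t <= s - t &
     (s - t) ^+ 2 - (phi s - phi t) ^+ 2 <= 4 * (s - t) * (psi s - psi t)]].
Proof.
move=> mu0 muh; have h0 : 0 < h by lra.
pose j (t : R) : int := Num.floor (t / h).
pose J (t : R) : R := (j t)%:~R.
(* The slope of [phi] on the cell from [i h] to [(i + 1) h]. *)
pose E (i : int) : R := (-1) ^ i.
have jP t : J t * h <= t < (J t + 1) * h.
  rewrite -ler_pdivlMr// -ltr_pdivrMr// /J /j.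
  by rewrite floor_le/= -[1 in ltRHS]/(1%:~R) -intrD floorD1_gt.
have E2 i : E i = 1 \/ E i = -1.
  have : E i ^+ 2 = 1 by rewrite expr2 /E -expfzMl mulrNN mul1r exp1rz.
  by move/eqP; rewrite sqrf_eq1 => /orP[] /eqP; [left|right].
pose phi t := (1 - E (j t)) / 2 * h + E (j t) * (t - J t * h).
pose psi t := J t * mu + Num.min (t - J t * h) mu.
have psiP t : psi t <= J t * mu + mu /\ psi t <= J t * mu + (t - J t * h) /\
    (psi t = J t * mu + mu /\ mu <= t - J t * h
     \/ psi t = J t * mu + (t - J t * h) /\ t - J t * h <= mu).
  rewrite /psi; case: (leP (t - J t * h) mu) => ?; (split; first lra); (split; first lra).
    by right.
  by left; split => //; lra.
have J0 : J 0 = 0 by rewrite /J /j mul0r floor0.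
exists phi, psi; split.
- by rewrite /phi J0 /j mul0r floor0 /E expr0z subrr !mul0r subr0 mulr0 addr0.
- by rewrite /psi J0 !mul0r subr0 add0r; apply/min_idPl; lra.
- move=> t; rewrite ler_norml /phi; have := jP t.
  by case: (E2 (j t)) => ->; lra.
- move=> t; have := jP t.
  have ht : mu * `|t| = mu / h * `|t| * h by field; lra.
  have := ler_norm t; have := lerNnormlW (lexx `|t|).
  have : 0 <= mu / h * `|t| by rewrite !mulr_ge0// ?invr_ge0; lra.
  move: ht; set k := mu / h * _; move=> kE k0 t1 t2 /andP[tj1 tj2].
  have [p1 [p2 p3]] := psiP t.
  have kJ : J t * mu <= k.
    rewrite -(ler_pM2r h0) -kE mulrAC [J t * h * mu]mulrC ler_wpM2l//; lra.
  have kJ' : - k <= (J t + 1) * mu.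
    rewrite -(ler_pM2r h0) mulNr -kE mulrAC [_ * h * mu]mulrC -mulrN ler_wpM2l//; lra.
  rewrite ler_norml; apply/andP; split; last lra.
  case: p3 => [][-> _]; lra.
move=> s t ts stmu.
have jts : (j t <= j s)%R by rewrite /j; apply: le_floor; rewrite ler_pM2r// invr_gt0.
have jst : (j s < j t + 2)%R.
  rewrite -(ltr_int R) intrD -/(J s) -/(J t).
  have /andP[s1 _] := jP s; have /andP[_ t2] := jP t.
  rewrite -(ltr_pM2r h0); lra.
have /andP[s1 s2] := jP s; have /andP[t1 t2] := jP t.
have [_ [_ ps]] := psiP s; have [_ [_ pt]] := psiP t.
(* As [s - t <= mu < h], at most one kink separates [t] from [s]. Without a kink, [phi] has slope 1
   or -1 and the left side of the last estimate vanishes. *)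
have [js|js] : j s = j t \/ j s = (j t + 1)%R.
  move: jts; rewrite le_eqVlt => /predU1P[->|]; [by left|right].
  apply/eqP; rewrite eq_le -ltzD1 -addrA jst/= lezD1; assumption.
  have Js : J s = J t by rewrite /J js.
  rewrite /phi Js js; rewrite Js in s1 s2 ps.
  have dpsi : 0 <= psi s - psi t <= s - t by case: ps => [][]; case: pt => [][]; lra.
  split=> //; case: (E2 (j t)) => ->.
  + by rewrite ger0_norm; lra.
  + by rewrite ler0_norm; lra.
  + by have /andP[] := dpsi; nra.
  + by have /andP[] := dpsi; nra.
have Js : J s = J t + 1 by rewrite /J js intrD.
have Es : E (j t + 1) = - E (j t).
  by rewrite /E expfzDr ?oppr_eq0 ?oner_eq0// expr1z mulrN1.
rewrite /phi Js js Es; rewrite Js in s1 s2 ps.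
have pse : psi s = (J t + 1) * mu + (s - (J t + 1) * h).
  by case: ps => [][]; lra.
have pte : psi t = (J t + 1) * mu by case: pt => [][]; lra.
rewrite pse pte; split.
- by rewrite ler_norml; case: (E2 (j t)) => ->; lra.
- by apply/andP; split; lra.
(* With [b] before and [a] after the kink, [phi] moves by [a - b] up to sign and [psi] by [a]; the
   claim becomes [4 a b <= 4 (a + b) a]. *)
set a := s - (J t + 1) * h in s1 *.
have [b bE] : exists b, b = (J t + 1) * h - t by eexists.
have -> : s - t = a + b by rewrite bE /a; lra.
have a0 : 0 <= a by rewrite /a; lra.
have b0 : 0 <= b by rewrite bE; lra.
have dphi : ((1 - - E (j t)) / 2 * h + - E (j t) * a
   - ((1 - E (j t)) / 2 * h + E (j t) * (t - J t * h))) ^+ 2 = (a - b) ^+ 2.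
  have -> : t - J t * h = h - b by rewrite bE; lra.
  by case: (E2 (j t)) => ->; field.
rewrite dphi; nra.
Qed.

End ApproxMidpoints.

(** * Approximate midpoints imply local almost squareness *)

Section AlmostSquare.
Context {R : realType} {M : metricType R} {x0 : M}.
Implicit Types (x y z w : lipfree x0) (f G H : Lip0 x0).

(* [square_cone f G H z c]: some [w] witnesses almost squareness at [z], at
   scale [c]; for [G] and [H] small at [z] and [z f] close to [c] close to 1, it
   says that [z + w] and [z - w] have norm about at most 1 and [w G] is about 1.
   This is a convex cone in [(z, c)]. *)
Definition square_cone f G H z : set R := [set c | exists w,
  [/\ `|z + w| <= 2 * c - z f + z G, `|z - w| <= 2 * c - z f - z G &
      z f - 4 * z H - 2 * (c - z f) <= w G]].

Section Cone.
Variables (f G H : Lip0 x0).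
Hypotheses (f1 : `|f| <= 1) (G1 : `|G| <= 1) (H1 : `|H| <= 1).

Let abs_le z g : `|g| <= 1 -> - `|z| <= z g <= `|z|.
Proof.
by move=> g1; rewrite lf_le1// lerNl -lfNr lf_le1// normrN.
Qed.

Lemma square_cone4 z : square_cone f G H z (4 * `|z|).
Proof.
exists 0; rewrite addr0 subr0.
have /andP[? ?] := abs_le z f1; have /andP[? ?] := abs_le z G1.
have /andP[? ?] := abs_le z H1; have := normr_ge0 z.
by split; rewrite -?[(0 : lipfree x0) G]/(0 : R); lra.
Qed.

Lemma square_cone_ge0 z c : square_cone f G H z c -> 0 <= c.
Proof.
move=> [w [h1 h2 _]]; have := ler_normD (z + w) (z - w).
rewrite addrACA subrr addr0 -mulr2n normrMn mulr2n.
have /andP[? ?] := abs_le z f1; have := normr_ge0 z; lra.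
Qed.

Lemma square_cone_sublinear : sublinear (fun z => inf (square_cone f G H z)).
Proof.
apply: inf_sublinear.
- by move=> z; exists (4 * `|z|); exact: square_cone4.
- by move=> z; exists 0 => c; exact: square_cone_ge0.
- move=> x y a b [u [u1 u2 u3]] [v [v1 v2 v3]]; exists (a + b) => //.
  exists (u + v); rewrite !lfDl (opprD u v) !(addrACA x y); split; last lra.
  + by have := ler_normD (x + u) (y + v); lra.
  + by have := ler_normD (x - u) (y - v); lra.
move=> x a t t0 [u [u1 u2 u3]]; exists (t * a) => //.
exists (t *: u); rewrite !lfZl -scalerBr -scalerDr !normrZ ger0_norm//.
by split; nra.
Qed.

End Cone.

(** The witness is [w = s z], with [z] the difference of evaluations and [s] the slope of [phi]
    between [f q] and [f p]. With [D = f p - f q] and [d] the distance, the norm conditions become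
    [(1 - s) (d - D) >= 0] and [(1 + s) (d - D) >= 0]; the third is the kink estimate for [phi] and
    [psi]. *)
Lemma square_cone_dirac f G H (p q : M) (phi psi : R -> R) :
  `|f| <= 1 -> (forall r, G r = phi (f r)) -> (forall r, H r = psi (f r)) ->
  (forall s t : R, t <= s -> s - t <= mdist p q ->
    [/\ `|phi s - phi t| <= s - t, 0 <= psi s - psi t <= s - t &
     (s - t) ^+ 2 - (phi s - phi t) ^+ 2 <= 4 * (s - t) * (psi s - psi t)]) ->
  square_cone f G H (dirac x0 p - dirac x0 q) (mdist p q).
Proof.
move=> f1 GE HE zz; set d := mdist p q.
have fpq : f p - f q <= d by exact: lip0_ler1.
have fqp : f q - f p <= d by rewrite /d metric_sym; exact: lip0_ler1.
set D := f p - f q; pose P := phi (f p) - phi (f q); pose S := psi (f p) - psi (f q).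
have D1 : D <= d by [].
have D2 : - D <= d by rewrite /D; lra.
suff [s [s1 sD s2]] : exists s : R, [/\ -1 <= s <= 1, P = s * D &
    D - 4 * S - 2 * (d - D) <= s * P].
  exists (s *: (dirac x0 p - dirac x0 q)).
  rewrite !lfZl !lfBl !diracE !GE !HE -/D -/P -/S.
  rewrite -[in X in X + s *: _](scale1r (dirac x0 p - dirac x0 q)).
  rewrite -[in X in X - s *: _](scale1r (dirac x0 p - dirac x0 q)).
  rewrite -scalerDl -scalerBl !normrZ dirac_dist -/d.
  have /andP[s3 s4] := s1.
  have -> : `|1 + s| = 1 + s by rewrite ger0_norm; lra.
  have -> : `|1 - s| = 1 - s by rewrite ger0_norm; lra.
  by rewrite sD; split=> //; nra.
have [D0|D0|D0] := ltgtP D 0.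
- have [] := zz (f q) (f p); [rewrite /D in D0; lra|by rewrite -opprB|].
  rewrite distrC -[f q - f p]opprB -[psi _ - psi _]opprB -/P -/D -/S.
  rewrite ler_norml => /andP[P1 P2] /andP[S1 S2] _.
  exists (P / D); split.
  + by rewrite ler_ndivlMr// ler_ndivrMr//; apply/andP; split; lra.
  + by rewrite divfK ?lt_eqF.
  (* For a descending pair [d - D] is at least [2 |D|], which absorbs the term [- 4 S]. *)
  suff : D <= P / D * P by lra.
  rewrite mulrAC ler_ndivlMr//; nra.
- have [] := zz (f p) (f q); [rewrite /D in D0; lra|by []|].
  rewrite ler_norml -/P -/D -/S => /andP[P1 P2] /andP[S1 S2] Q.
  exists (P / D); split.
  + by rewrite ler_pdivlMr// ler_pdivrMr//; apply/andP; split; lra.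
  + by rewrite divfK ?gt_eqF.
  suff : D - 4 * S <= P / D * P by lra.
  rewrite mulrAC ler_pdivlMr//; lra.
exists 0; have [] := zz (f p) (f q); [by rewrite -subr_ge0 -/D D0|by []|].
rewrite ler_norml -/P -/D -/S D0 => /andP[P1 P2] /andP[S1 S2] _.
by split; lra.
Qed.

(** A linear functional that is dominated by the gauge and equals it at [x] is 1-Lipschitz on close
    evaluations, hence on all of them, so it is given by an element of the unit ball of [Lip0]. *)
Lemma square_cone_le f G H mu x : approx_midpoints M -> 0 < mu ->
  `|f| <= 1 -> `|G| <= 1 -> `|H| <= 1 ->
  (forall p q, mdist p q <= mu ->
     square_cone f G H (dirac x0 p - dirac x0 q) (mdist p q)) ->
  inf (square_cone f G H x) <= `|x|.
Proof.
move=> mid mu0 f1 G1 H1 loc.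
have [l [ll lS <-]] := hahn_banach x (square_cone_sublinear f1 G1 H1).
have lb z : has_lbound (square_cone f G H z).
  by exists 0 => c; exact: square_cone_ge0.
have l4 z : l z <= 4 * `|z|.
  exact: le_trans (lS z) (ge_inf (lb z) (square_cone4 f1 G1 H1 z)).
have lB y z : l (y - z) = l y - l z.
  by rewrite addrC -scaleN1r ll mulN1r addrC.
have l0 : l 0 = 0 by have := lB 0 0; rewrite !subrr.
have [||g g1 ->] := @lipfree_functional _ _ x0 l 1 4 ler01 ll.
- move=> z; rewrite ler_norml l4 andbT lerNl.
  by have := l4 (0 - z); rewrite lB l0 !sub0r normrN.
- apply: (@lipschitz_of_local _ _ (l \o dirac x0) 1 mu) => // a b ab.
  rewrite mul1r /= -lB; exact: le_trans (lS _) (ge_inf (lb _) (loc _ _ ab)).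
exact: lf_le1.
Qed.

Lemma lasq_witness x (e : R) : approx_midpoints M -> `|x| = 1 -> 0 < e ->
  exists w, [/\ `|x + w| <= 1 + 5 * e, `|x - w| <= 1 + 5 * e & 1 - 13 * e <= `|w|].
Proof.
move=> mid x1 e0.
have [f f1 xf] : exists2 f : Lip0 x0, `|f| <= 1 & 1 - e < x f.
  by apply: lipfree_norming; lra.
have [n [c [p xs]]] := dirac_dense x e0.
set s := \sum_(i < n) _ in xs.
pose A := \sum_(i < n) `|c i|; pose B := \sum_(i < n) `|c i| * `|f (p i)|.
have A0 : 0 <= A by rewrite /A; apply: sumr_ge0 => i _; exact: normr_ge0.
have B0 : 0 <= B by rewrite /B; apply: sumr_ge0 => i _; rewrite mulr_ge0.
(* [A h <= e] makes [s G] at most [e], since [|G| <= h] pointwise; [mu (B / h + 2 A) <= e] will do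
   the same for [s H]. *)
pose h := e / (A + 1); have h0 : 0 < h by rewrite divr_gt0//; lra.
have hA : A * h <= e by rewrite /h mulrA ler_pdivrMr; nra.
pose K := B / h + 2 * A + 1.
have K0 : 0 < K by rewrite /K; have : 0 <= B / h; [rewrite divr_ge0// ltW|lra].
pose mu := Num.min (h / 2) (e / K).
have mu0 : 0 < mu by rewrite lt_min (divr_gt0 h0)// (divr_gt0 e0).
have mue : mu * K <= e by rewrite -ler_pdivlMr// ge_min lexx orbT.
have muh : 2 * mu <= h by have : mu <= h / 2; [rewrite ge_min lexx|lra].
have [phi [psi [phi0 psi0 phih psih zz]]] := zigzag mu0 muh.
have zzd (a b : M) : mdist a b <= mu -> forall s t : R, t <= s -> s - t <= mdist a b ->
    [/\ `|phi s - phi t| <= s - t, 0 <= psi s - psi t <= s - t &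
     (s - t) ^+ 2 - (phi s - phi t) ^+ 2 <= 4 * (s - t) * (psi s - psi t)].
  by move=> ab s' t ts st; apply: zz => //; apply: le_trans ab.
have steep (a b : M) : mdist a b <= mu ->
    phi (f a) - phi (f b) <= mdist a b /\ psi (f a) - psi (f b) <= mdist a b.
  move=> ab; have fab := lip0_ler1 a b f1; have fba := lip0_ler1 b a f1.
  rewrite metric_sym in fba.
  have [le|le] := leP (f b) (f a).
    have [+ /andP[_ h2] _] := zzd _ _ ab _ _ le fab.
    rewrite ler_norml => /andP[_ h1]; split; lra.
  have [+ /andP[h2 _] _] := zzd _ _ ab _ _ (ltW le) fba.
  rewrite ler_norml => /andP[h1 _]; split; lra.
have [G G1 GE] : exists2 G : Lip0 x0, `|G| <= 1 & forall r, G r = phi (f r).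
  have [|G G1 GE] := @lip0_of_fun _ _ x0 (phi \o f) 1 ler01.
    apply: (lipschitz_of_local mid ler01 mu0) => a b ab.
    by rewrite mul1r; have [] := steep _ _ ab.
  by exists G => // r; rewrite GE /= lip0_at0 phi0 subr0.
have [H H1 HE] : exists2 H : Lip0 x0, `|H| <= 1 & forall r, H r = psi (f r).
  have [|H H1 HE] := @lip0_of_fun _ _ x0 (psi \o f) 1 ler01.
    apply: (lipschitz_of_local mid ler01 mu0) => a b ab.
    by rewrite mul1r; have [] := steep _ _ ab.
  by exists H => // r; rewrite HE /= lip0_at0 psi0 subr0.
have small g b : `|g| <= 1 -> `|s g| <= b -> `|x g| <= e + b.
  move=> g1 sg; rewrite -[x](subrK s) lfDl.
  apply: le_trans (ler_normD _ _) _; apply: lerD => //.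
  apply: le_trans (lf_normr_le _ _) _.
  by rewrite -[leRHS]mulr1 ler_pM// ltW.
have xG : `|x G| <= e + e.
  apply: small => //; apply: le_trans hA; rewrite /s lf_sum_dirac mulr_suml.
  apply: le_trans (ler_norm_sum _ _ _) _; apply: ler_sum => i _.
  by rewrite normrM GE ler_wpM2l.
have xH : `|x H| <= e + e.
  apply: small => //; apply: (@le_trans _ _ (mu / h * B + 2 * mu * A)); last first.
    by apply: le_trans mue; rewrite /K mulrDr mulrDr mulr1 mulrAC -mulrA; lra.
  rewrite /s lf_sum_dirac !mulr_sumr -big_split/=.
  apply: le_trans (ler_norm_sum _ _ _) _; apply: ler_sum => i _.
  rewrite normrM HE mulrCA [2 * mu * _]mulrC -mulrDr.
  by rewrite ler_wpM2l.
have := @square_cone_le f G H mu x mid mu0 f1 G1 H1 _; rewrite x1 => P0.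
have P1 : inf (square_cone f G H x) <= 1.
  by apply: P0 => a b ab; apply: (square_cone_dirac f1 GE HE); exact: zzd.
have [|c0 [w [w1 w2 w3]] c1] := @inf_adherent _ (square_cone f G H x) e e0.
  split; first by exists (4 * `|x|); exact: square_cone4.
  by exists 0 => c'; exact: square_cone_ge0.
move: xG xH; rewrite !ler_norml => /andP[G2 G3] /andP[H2 H3].
(* With [x f > 1 - e], [c0 < 1 + e] and [x G], [x H] at most [2 e] in absolute value, the bounds are
   [2 (1 + e) - (1 - e) + 2 e = 1 + 5 e] and [(1 - e) - 8 e - 4 e = 1 - 13 e]. *)
exists w; split; [lra|lra|].
have := lf_le1 w G1; lra.
Qed.

Theorem lasq_of_approx_midpoints :
  approx_midpoints M -> locally_almost_square (lipfree x0).
Proof.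
move=> mid eps eps0 x x1.
(* The error [18 e] is [5 e] from the witness plus [13 e] from normalizing it; [e <= 1 / 26] keeps
   the norm of [w] at least [1 / 2]. *)
pose e := Num.min (eps / 18) (1 / 26).
have e0 : 0 < e by rewrite lt_min !divr_gt0.
have e1 : 18 * e <= eps by rewrite mulrC -ler_pdivlMr// ge_min lexx.
have e18 : 1 + 5 * e + 13 * e <= 1 + eps by lra.
have e2 : e <= 1 / 26 by rewrite ge_min lexx orbT.
have [w [w1 w2 w3]] := lasq_witness mid x1 e0.
have wgt0 : 0 < `|w| by lra.
have wle : `|w| <= 1 + 5 * e.
  have := ler_normB (x + w) (x - w).
  have -> : x + w - (x - w) = w *+ 2 by rewrite opprB addrC addrA subrK mulr2n.
  rewrite normrMn mulr2n; lra.
have [y y1 yw] : exists2 y, `|y| = 1 & `|y - w| <= 13 * e.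
  exists (`|w|^-1 *: w); first by rewrite normrZ normfV normr_id mulVf ?gt_eqF.
  rewrite -[X in _ - X]scale1r -scalerBl normrZ.
  rewrite -[X in _ * X]ger0_norm// -normrM mulrBl mul1r mulVf ?gt_eqF//.
  by rewrite ler_norml; apply/andP; split; lra.
exists y; split => //.
- have -> : x + y = (x + w) + (y - w) by rewrite addrACA subrr addr0.
  apply: (le_trans (ler_normD _ _)).
  exact: le_trans (lerD w1 yw) e18.
have -> : x - y = (x - w) - (y - w) by rewrite opprB addrA subrK.
apply: (le_trans (ler_normB _ _)); exact: le_trans (lerD w2 yw) e18.
Qed.

End AlmostSquare.

(** * Close steep pairs far from a finite set *)

Section SteepPair.
Context {R : realType}.

Definition clamp (c x : R) : R := Num.max (- c) (Num.min c x).

Lemma clampP c x y : 0 <= c -> x <= y ->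
  [/\ - c <= clamp c x <= c, 0 <= clamp c y - clamp c x <= y - x &
      - c <= x -> y <= c -> clamp c y - clamp c x = y - x].
Proof.
move=> c0 xy.
have clE z : [\/ z <= - c /\ clamp c z = - c, - c <= z <= c /\ clamp c z = z |
    c <= z /\ clamp c z = c].
  rewrite /clamp; have [cz|zc] := leP c z.
    by apply: Or33; split=> //; apply/max_idPr; lra.
  have [cz|cz] := leP (- c) z; first by apply: Or32; split=> //; apply/andP; split; lra.
  by apply: Or31; split; lra.
case: (clE x) => -[+ ->]; case: (clE y) => -[+ ->] => hy hx.
all: by split; [apply/andP; split; lra|apply/andP; split; lra|move=> *; lra].
Qed.

Context {M : metricType R} {x0 : M}.
Implicit Types (f g : Lip0 x0).

(* Otherwise [(n + 1) f - \sum_i clamp (f - f (k i))] has, locally and hence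
   globally, a Lipschitz constant too small for a pair of points at which [f] is
   nearly as steep as possible: near [k i] the [i]-th summand cancels one copy
   of [f]. *)
Lemma steep_far_pair n (k : 'I_n -> M) f (eps : R) :
  approx_midpoints M -> 0 < eps -> eps <= `|f| ->
  exists2 r : R, 0 < r & forall mu : R, 0 < mu -> exists u v : M,
    [/\ u != v, mdist u v <= mu, (`|f| - eps) * mdist u v < f u - f v &
        forall i, r <= mdist u (k i)].
Proof.
move=> mid eps0; set lam := `|f| => epslam.
have n0 : 0 <= n%:R :> R by [].
have n1 : 0 < 2 * (1 + n%:R) :> R by lra.
(* At the pair [a], [b] the [n + 1] copies of [f] then lose at most [eps / 2] in slope. *)
pose th := eps / (2 * (1 + n%:R)).
have th0 : 0 < th by rewrite divr_gt0.
have thE : th * (2 * (1 + n%:R)) = eps by rewrite divfK ?gt_eqF.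
have [||a [b [ab fab]]] := @lip0_steep _ _ _ f (lam - th).
- have : th <= eps; last lra.
  rewrite -thE; nra.
- rewrite -/lam ltrBlDr ltrDl; exact: th0.
have D0 : 0 < mdist a b by rewrite mdist_gt0.
set D := mdist a b in D0 fab.
have ln0 : 0 < 8 * lam * (1 + n%:R) by rewrite !mulr_gt0//; lra.
(* Each clamp varies by at most [4 r lam], so all [n] of them together cost at most [eps / 2 * D] at
   [a], [b]. *)
pose r := eps * D / (8 * lam * (1 + n%:R)).
have r0 : 0 < r by rewrite divr_gt0// mulr_gt0.
have rE : r * (8 * lam * (1 + n%:R)) = eps * D by rewrite divfK ?gt_eqF.
exists r => // mu mu0; apply: contrapT => H.
pose cl i z := clamp (2 * r * lam) (f z - f (k i)).
pose F z := (1 + n%:R) * f z - \sum_(i < n) cl i z.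
have lam0 : 0 < lam by lra.
have c0 : 0 <= 2 * r * lam by rewrite !pmulr_lge0// ltW.
pose C := (1 + n%:R) * lam - eps.
have C0 : 0 <= C by rewrite /C; have := mulr_ge0 n0 (ltW lam0); lra.
have FE u v : F u - F v = (1 + n%:R) * (f u - f v) - \sum_(i < n) (cl i u - cl i v).
  by rewrite /F sumrB; ring.
have small : 0 < Num.min mu r by rewrite lt_min mu0.
have : F a - F b <= C * D.
  apply: (lipschitz_of_local mid C0 small) => u v; rewrite le_min => /andP[uvmu uvr].
  rewrite FE; set t := f u - f v.
  have tlam : t <= lam * mdist u v by exact: lip0_ler.
  have d0 := mdist_ge0 u v.
  have [t0|t0] := leP t 0.
    have : n%:R * t <= \sum_(i < n) (cl i u - cl i v).
      rewrite -[n in n%:R]card_ord -sumr_const mulr_suml.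
      apply: ler_sum => i _; rewrite mul1r /cl.
      have [|_ /andP[_ +] _] := @clampP (2 * r * lam) (f u - f (k i)) (f v - f (k i)) c0.
        by rewrite /t in t0; lra.
      rewrite /t; lra.
    have : 0 <= C * mdist u v by rewrite mulr_ge0.
    lra.
  have clge i : 0 <= cl i u - cl i v.
    have [|_ /andP[+ _] _] := @clampP (2 * r * lam) (f v - f (k i)) (f u - f (k i)) c0.
      by rewrite /t in t0; lra.
    by [].
  (* Within [r] of [k i], the [i]-th clamp does not truncate at [u] and [v], so [F] rises by at most
     [n t]. Elsewhere the negated conclusion bounds the slope of [f] by [lam - eps]. *)
  have [[i ir]|far] := pselect (exists i, mdist u (k i) < r).
    have cli : cl i u - cl i v = t.
      have [|_ _ ->] := @clampP (2 * r * lam) (f v - f (k i)) (f u - f (k i)) c0.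
      - by rewrite /t in t0; lra.
      - by rewrite /t; ring.
      - have := lip0_ler f (k i) v; rewrite -/lam.
        have := metric_triangle (k i) u v; rewrite (metric_sym (k i) u) => tri.
        have : lam * mdist (k i) v <= lam * (2 * r) by rewrite ler_wpM2l//; lra.
        lra.
      - have := lip0_ler f u (k i); rewrite -/lam.
        have : lam * mdist u (k i) <= lam * (2 * r) by rewrite ler_wpM2l//; lra.
        lra.
    rewrite (bigD1 i)//= cli.
    have : 0 <= \sum_(j < n | j != i) (cl j u - cl j v) by apply: sumr_ge0.
    have : n%:R * t <= n%:R * (lam * mdist u v) by rewrite ler_wpM2l.
    have : 0 <= (lam - eps) * mdist u v by rewrite mulr_ge0//; lra.
    rewrite /C; lra.
  have : 0 <= \sum_(j < n) (cl j u - cl j v) by apply: sumr_ge0.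
  have : t <= (lam - eps) * mdist u v.
    rewrite leNgt; apply/negP => steep; apply: H; exists u, v; split => //.
      by apply: contraTneq t0 => uv; rewrite /t uv subrr ltxx.
    by move=> i; rewrite leNgt; apply/negP => ?; apply: far; exists i.
  move=> tl; have : (1 + n%:R) * t <= (1 + n%:R) * ((lam - eps) * mdist u v).
    by rewrite ler_wpM2l//; lra.
  have : 0 <= n%:R * (eps * mdist u v) by rewrite !mulr_ge0// ltW.
  rewrite /C; lra.
rewrite FE.
have : \sum_(i < n) (cl i a - cl i b) <= \sum_(i < n) (4 * r * lam).
  apply: ler_sum => i _.
  have [/andP[_ +] _ _] := clampP c0 (lexx (f a - f (k i))).
  have [/andP[+ _] _ _] := clampP c0 (lexx (f b - f (k i))).
  rewrite /cl; lra.
rewrite sumr_const card_ord -mulr_natl => S1.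
have : (1 + n%:R) * ((lam - th) * D) < (1 + n%:R) * (f a - f b).
  by rewrite ltr_pM2l//; lra.
have : (1 + n%:R) * ((lam - th) * D) = (1 + n%:R) * lam * D - eps / 2 * D.
  by rewrite -thE; field.
have : n%:R * (4 * r * lam) <= eps / 2 * D.
  have : 0 <= 4 * r * lam by lra.
  have := rE; lra.
rewrite /C; lra.
Qed.

End SteepPair.

(** * Approximate midpoints imply the Daugavet property *)

Section Daugavet.
Context {R : realType} {M : metricType R} {x0 : M}.
Implicit Types (f g : Lip0 x0).

(** Take the maximum of [g0] and a cone of slope [1 + eta] with apex value [g0 v + s] at [u]. The
    excess slope [eta] brings the cone below [g0] at distance [r], because [2 s <= eta r]; at [v]
    the maximum is still [g0 v]. *)
Lemma lip0_bump n (k : 'I_n -> M) g0 (u v : M) (r eta : R) :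
  `|g0| <= 1 -> 0 < eta -> 2 * mdist u v <= eta * r ->
  (forall i, r <= mdist u (k i)) -> r <= mdist u x0 ->
  exists g : Lip0 x0, [/\ `|g| <= 1 + eta, mdist u v <= g u - g v &
    forall i, g (k i) = g0 (k i)].
Proof.
move=> g01 eta0; set s := mdist u v => sr uk ux0.
have g0l p q : g0 p - g0 q <= mdist p q by exact: lip0_ler1.
have s0 : 0 <= s by exact: mdist_ge0.
pose b z := Num.max (g0 z) (g0 v + s - (1 + eta) * mdist u z).
have far z : r <= mdist u z -> b z = g0 z.
  move=> rz; apply/max_idPl.
  have := g0l v z; have := metric_triangle v u z; rewrite (metric_sym v u) -/s.
  have : eta * r <= eta * mdist u z by rewrite ler_pM2l.
  lra.
have [||g g1 gE] := @lip0_of_fun _ _ x0 b (1 + eta).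
- lra.
- move=> p q.
  have h1 := g0l p q; have h2 := metric_triangle u p q; have h3 := mdist_ge0 p q.
  have h4 : 0 <= eta * mdist p q by rewrite mulr_ge0// ltW.
  have h5 : (1 + eta) * mdist u q <= (1 + eta) * (mdist u p + mdist p q).
    by rewrite ler_wpM2l//; lra.
  have h6 : g0 q <= b q by rewrite le_max lexx.
  have h7 : g0 v + s - (1 + eta) * mdist u q <= b q by rewrite le_max lexx orbT.
  rewrite lerBlDr {1}/b ge_max; apply/andP; split; first lra.
  lra.
have {}gE z : g z = b z by rewrite gE (far _ ux0) lip0_at0 subr0.
exists g; split => // [|i]; last by rewrite gE far.
rewrite !gE.
have -> : b v = g0 v by apply/max_idPl; rewrite -/s; nra.
have : g0 v + s <= b u by rewrite le_max mdistxx mulr0 subr0 lexx orbT.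
lra.
Qed.

Lemma rank_oneP (T : {linear lipfree x0 -> lipfree x0}) :
  bounded_op T -> rank_one T ->
  exists (f : Lip0 x0) (e : lipfree x0), [/\ f != 0, e != 0 & forall x, T x = x f *: e].
Proof.
move=> [C TC] [e e0 rT].
have aT0 x : exists a : R, T x = a *: e.
  have : range T (T x) by exists x.
  by rewrite rT => -[a _ <-]; exists a.
have [a aT] := choice aT0.
have ne0 : 0 < `|e| by rewrite normr_gt0.
have al c x y : a (c *: x + y) = c * a x + a y.
  apply/eqP; rewrite -subr_eq0; suff : (a (c *: x + y) - (c * a x + a y)) *: e = 0.
    by move/eqP; rewrite scaler_eq0 (negPf e0) orbF.
  by rewrite scalerBl scalerDl -scalerA -!aT linearP subrr.
have aC x : `|a x| <= C / `|e| * `|x|.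
  by rewrite mulrAC ler_pdivlMr// -normrZ -aT.
have [||f _ af] := @lipfree_functional _ _ x0 a `|C / `|e| | (C / `|e|) _ al aC.
- by [].
- move=> p q; have aB : a (dirac x0 p - dirac x0 q) = a (dirac x0 p) - a (dirac x0 q).
    by rewrite addrC -scaleN1r al mulN1r addrC.
  rewrite -aB -(@dirac_dist _ _ x0); apply: le_trans (ler_norm _) _.
  by apply: (le_trans (aC _)); rewrite ler_wpM2r// ler_norm.
exists f, e; split => // [|x]; last by rewrite aT af.
have : range T e by rewrite rT; exists 1 => //; rewrite scale1r.
move=> [x _ Tx]; apply: contraNneq e0 => f0.
by rewrite -Tx aT af f0 lf0r scale0r.
Qed.

(** The vector [z + z f *: e], for [z] the difference of evaluations at a close steep pair of [f],
    is tested against a function that is steep at this pair and still almost norms [e]. *)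
Lemma daugavet_estimate f (e : lipfree x0) (N lam E eta : R) :
  approx_midpoints M -> lam = `|f| -> E = `|e| ->
  (forall z : lipfree x0, `|z + z f *: e| <= N * `|z|) ->
  0 < eta -> eta <= 1 -> eta <= lam -> 4 * eta <= E ->
  1 + lam * E <= N + eta * (N + E + 4 * lam).
Proof.
move=> mid lamE EE NP eta0 eta1 etalam etaE.
have [g0 g01 eg0] : exists2 g : Lip0 x0, `|g| <= 1 & E - eta < e g.
  by apply: lipfree_norming; rewrite -EE; lra.
have [n [c [p]]] := dirac_dense e eta0; set s := \sum_(i < n) _ => es.
(* Index [0] stands for the base point, which the bump must avoid as well. *)
pose k (i : 'I_n.+1) := if unlift ord0 i is Some j then p j else x0.
have etaf : eta <= `|f| by rewrite -lamE.
have [r r0] := steep_far_pair k mid eta0 etaf; rewrite -lamE => far.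
have mu0 : 0 < eta * r / 2 by rewrite divr_gt0// mulr_gt0.
have [u [v [uv uvmu fuv uk]]] := far _ mu0.
have d0 : 0 < mdist u v by rewrite mdist_gt0.
have [|||g [g1 guv gk]] := @lip0_bump n p g0 u v r eta g01 eta0.
- lra.
- by move=> i; have := uk (lift ord0 i); rewrite /k liftK.
- by have := uk ord0; rewrite /k unlift_none.
pose z := dirac x0 u - dirac x0 v.
have zN : `|z + z f *: e| <= N * mdist u v.
  by rewrite -(@dirac_dist _ _ x0 u v).
have sg : s g = s g0 by rewrite !lf_sum_dirac; apply: eq_bigr => i _; rewrite gk.
(* As [g] and [g0] agree on [s], the values [e g] and [e g0] differ only through [e - s], of norm
   below [eta]. *)
have eg : E - 4 * eta <= e g.
  have : (e - s) (g0 - g) <= eta * (1 + (1 + eta)).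
    apply: (le_trans (lf_le _ _)); apply: ler_pM => //; first exact: ltW.
    by apply: (le_trans (ler_normB _ _)); rewrite lerD.
  rewrite lfBr !lfBl sg; nra.
have := lf_le (z + z f *: e) g; rewrite lfDl lfZl.
have -> : z g = g u - g v by [].
have -> : z f = f u - f v by [].
have h1 : (lam - eta) * mdist u v * (E - 4 * eta) <= (f u - f v) * e g.
  by apply: ler_pM => //; [rewrite mulr_ge0//; lra|lra|exact: ltW].
have h2 : `|z + z f *: e| * `|g| <= N * mdist u v * (1 + eta) by apply: ler_pM.
move=> h3; have h4 := le_trans (lerD guv h1) (le_trans h3 h2).
rewrite -(ler_pM2r d0).
have h5 : 0 <= eta * eta * mdist u v by rewrite mulr_ge0 ?mulr_ge0// ltW.
move: h4 h5; clear.
set d := mdist u v; lra.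
Qed.

Lemma le_of_estimate (N lam E : R) : 0 <= N -> 0 < lam -> 0 < E ->
  (forall eta : R, 0 < eta -> eta <= 1 -> eta <= lam -> 4 * eta <= E ->
    1 + lam * E <= N + eta * (N + E + 4 * lam)) ->
  1 + lam * E <= N.
Proof.
move=> N0 lam0 E0 key.
apply/ler_addgt0Pr => d d0; pose K := N + E + 4 * lam.
have K0 : 0 < K by rewrite /K; lra.
pose eta := Num.min (Num.min 1 lam) (Num.min (E / 4) (d / K)).
have eta0 : 0 < eta by rewrite !lt_min ltr01 lam0 !divr_gt0.
have etaE : [&& eta <= 1, eta <= lam, eta <= E / 4 & eta <= d / K].
  by rewrite /eta !ge_min !lexx !orbT.
have /and4P[h1 h2 h3 h4] := etaE.
have h5 : eta * K <= d by rewrite -ler_pdivlMr.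
apply: le_trans (key eta eta0 h1 h2 _) _; first lra.
by rewrite lerD2l.
Qed.

Theorem daugavet_of_approx_midpoints :
  approx_midpoints M -> Daugavet_property (lipfree x0).
Proof.
move=> mid T bT rT; have [f [e [f0 e0 TE]]] := rank_oneP bT rT.
have bIT : bounded_op (idfun \+ T).
  have [C TC] := bT; exists (1 + C) => x.
  by apply: (le_trans (ler_normD _ _)); rewrite mulrDl mul1r lerD2l.
have lIT : linear (idfun \+ T).
  by move=> a x y /=; rewrite linearP scalerDr addrACA.
apply/eqP; rewrite eq_le; apply/andP; split.
  apply: opnorm_le => x x1; apply: (le_trans (ler_normD _ _)).
  by rewrite lerD// opnorm_ub.
have TlE : opnorm T <= `|f| * `|e|.
  apply: opnorm_le => x x1; rewrite TE normrZ ler_wpM2r//.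
  apply: (le_trans (lf_normr_le _ _)).
  by rewrite -[leRHS]mul1r ler_wpM2r.
have NP (z : lipfree x0) : `|z + z f *: e| <= opnorm (idfun \+ T) * `|z|.
  by rewrite -TE; exact: opnormP z lIT bIT.
apply: (@le_trans _ _ (1 + `|f| * `|e|)); first by rewrite lerD2l.
apply: le_of_estimate; rewrite ?normr_gt0//; first exact: opnorm_ge0.
by move=> eta; apply: daugavet_estimate mid _ _ NP.
Qed.

End Daugavet.

(** * Either property of the free space yields functions with opposite slopes *)

Section OppositeSlopes.
Context {R : realType}.

Definition nonexpansive (M : metricType R) (a : M -> R) : Prop :=
  forall p q, a p - a q <= mdist p q.

Definition steep (M : metricType R) (a : M -> R) (th : R) (p q : M) : Prop :=
  p != q /\ (1 - th) * mdist p q <= a p - a q.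

(** Plain functions make this independent of the base point; the factor [9] covers the losses in
    both derivations below. *)
Definition opposite_slopes (M : metricType R) : Prop :=
  forall (f : M -> R) (th : R), 0 < th -> th <= 1 / 20 ->
  nonexpansive f -> (exists p q, steep f th p q) ->
  exists (g : M -> R) (u v u' v' : M), [/\ nonexpansive g,
    steep f (9 * th) u v, steep g (9 * th) u v,
    steep f (9 * th) u' v' & steep g (9 * th) v' u'].

Context {M : metricType R} {x0 : M}.
Implicit Types (f g : Lip0 x0).

Lemma common_steep_pair f g (th : R) : `|f| <= 1 -> `|g| <= 1 ->
  0 <= th <= 2 -> 2 - th < `|f + g| ->
  exists u v : M, steep f th u v /\ steep g th u v.
Proof.
move=> f1 g1 th02 fg; have [|u [v [uv]]] := @lip0_steep _ _ _ (f + g) _ _ fg; first lra.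
have -> : (f + g) u - (f + g) v = (f u - f v) + (g u - g v).
  by rewrite -[(f + g) u]/(f u + g u) -[(f + g) v]/(f v + g v) opprD addrACA.
have := lip0_ler1 u v f1; have := lip0_ler1 u v g1 => h1 h2 h3.
by exists u, v; split; split => //; lra.
Qed.

Lemma molecule p q : p != q -> exists2 x : lipfree x0, `|x| = 1 &
  forall f, x f * mdist p q = f p - f q.
Proof.
move=> pq; have d0 : 0 < mdist p q by rewrite mdist_gt0.
exists ((mdist p q)^-1 *: (dirac x0 p - dirac x0 q)).
  by rewrite normrZ dirac_dist gtr0_norm ?invr_gt0// mulVf ?gt_eqF.
by move=> f; rewrite lfZl lfBl !diracE mulrAC mulVf ?gt_eqF// mul1r.
Qed.

Let lip0_sub (f : M -> R) : nonexpansive f ->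
  exists2 f' : Lip0 x0, `|f'| <= 1 & forall p q, f' p - f' q = f p - f q.
Proof.
move=> f1; have [|f' f'1 f'E] := @lip0_of_fun _ _ x0 f 1 ler01.
  by move=> p q; rewrite mul1r.
by exists f' => // p q; rewrite !f'E; ring.
Qed.

(** Let [g] norm [y]. Testing [x + y] on [f + g] and [x - y] on [f - g] and adding cancels the mixed
    terms [y f] and [x g], so both [f + g] and [f - g] have norm almost 2. *)
Theorem opposite_slopes_of_lasq :
  locally_almost_square (lipfree x0) -> opposite_slopes M.
Proof.
move=> lasq f0 th th0 th1 /lip0_sub[f f1 fE] [p [q [pq]]]; rewrite -fE => fpq.
have [x x1 xE] := molecule pq.
have d0 : 0 < mdist p q by rewrite mdist_gt0.
have xf : 1 - th <= x f by rewrite -(ler_pM2r d0) xE.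
have [y [y1 xy1 xy2]] := lasq th th0 x x1.
have [g g1 yg] : exists2 g : Lip0 x0, `|g| <= 1 & 1 - th < y g.
  by apply: lipfree_norming; rewrite y1; lra.
have fg2 : `|f + g| <= 2 by have := ler_normD f g; lra.
have fg2' : `|f - g| <= 2 by have := ler_normB f g; lra.
have h1 : (x + y) (f + g) <= (1 + th) * `|f + g|.
  by apply: (le_trans (lf_le _ _)); rewrite ler_wpM2r.
have h2 : (x - y) (f - g) <= (1 + th) * `|f - g|.
  by apply: (le_trans (lf_le _ _)); rewrite ler_wpM2r.
rewrite lfDr !lfDl in h1; rewrite lfBr !lfBl in h2.
have h3 : (1 + th) * `|f + g| <= (1 + th) * 2 by rewrite ler_wpM2l//; lra.
have h4 : (1 + th) * `|f - g| <= (1 + th) * 2 by rewrite ler_wpM2l//; lra.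
have h5 : 2 - 9 * th < `|f + g| by nra.
have h6 : 2 - 9 * th < `|f - g| by nra.
have th9 : 0 <= 9 * th <= 2 by apply/andP; split; lra.
have [u [v [[uv uv1] [_ uv2]]]] := common_steep_pair f1 g1 th9 h5.
have [|u' [v' [[uv' uv1'] [_ uv2']]]] := @common_steep_pair f (- g) _ f1 _ th9 h6.
  by rewrite normrN.
exists g, u, v, u', v'; split => //; try by split => //; rewrite -fE.
- by move=> a b; exact: lip0_ler1.
split; first by rewrite eq_sym.
rewrite metric_sym.
by rewrite -[(- g) u']/(- g u') -[(- g) v']/(- g v') in uv2'; lra.
Qed.

Theorem opposite_slopes_of_daugavet :
  Daugavet_property (lipfree x0) -> opposite_slopes M.
Proof.
move=> daug f0 th th0 th1 /lip0_sub[f f1 fE] [p [q [pq]]]; rewrite -fE => fpq.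
have [x x1 xE] := molecule pq.
have d0 : 0 < mdist p q by rewrite mdist_gt0.
have xf : 1 - th <= x f by rewrite -(ler_pM2r d0) xE.
suff [y [g [yf g1 yfg xg]]] : exists (y : lipfree x0) g,
    [/\ `|y| <= 1, `|g| <= 1, 2 - 4 * th < y (f + g) & x g <= - (1 - 2 * th)].
  have th9 : 0 <= 9 * th <= 2 by apply/andP; split; lra.
  have fg : 2 - 9 * th < `|f + g|.
    have := lf_le y (f + g); have := normr_ge0 (f + g); nra.
  have [u [v [[uv uv1] [_ uv2]]]] := common_steep_pair f1 g1 th9 fg.
  exists g, u, v, p, q; split => //; try by split => //; rewrite -fE.
  - by move=> a b; exact: lip0_ler1.
  - split; rewrite // -fE; apply: le_trans fpq; rewrite ler_wpM2r ?mdist_ge0//; lra.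
  - split; first by rewrite eq_sym.
    rewrite metric_sym; have : g q - g p = (- x g) * mdist p q by rewrite mulNr xE opprB.
    move=> ->; rewrite ler_wpM2r ?mdist_ge0//; lra.
(* Such a [y] and [g] force [y f] and [x g] to be close to 1 in absolute value, with opposite signs;
   negating [y] and [g] if necessary makes [y f] the positive one. *)
suff [y [g [y1 g1 yxg]]] : exists (y : lipfree x0) g,
    [/\ `|y| <= 1, `|g| <= 1 & 2 - 2 * th < y g - y f * x g].
  have abs1 (z : lipfree x0) h : `|z| <= 1 -> `|h| <= 1 -> -1 <= z h <= 1.
    move=> z1 h1; rewrite -ler_norml; apply: (le_trans (lf_normr_le z h)).
    by rewrite -[leRHS]mulr1 ler_pM.
  have ar (a b c : R) : 0 <= a <= 1 -> -1 <= b <= 1 -> c <= 1 ->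
      2 - 2 * th < c - a * b -> 2 - 4 * th < a + c /\ b <= - (1 - 2 * th).
    move=> /andP[a0 a1] /andP[b1 b2] c1 abc.
    have ab1 : 0 <= a * (1 + b) by rewrite mulr_ge0//; lra.
    split; first lra.
    have [b0|b0] := leP 0 b; first by have := mulr_ge0 a0 b0; lra.
    have : 0 <= (1 - a) * - b by rewrite mulr_ge0//; lra.
    lra.
  have /andP[yf1 yf2] := abs1 _ _ y1 f1.
  have /andP[yg1 yg2] := abs1 _ _ y1 g1.
  have x1' : `|x| <= 1 by rewrite x1.
  have xg := abs1 _ _ x1' g1.
  have [yf0|yf0] := leP 0 (y f).
    exists y, g; rewrite lfDr.
    by have [||||h1 h2] := ar (y f) (x g) (y g); rewrite ?yf0.
  exists (- y), (- g); rewrite !normrN lfDr !lfNl !lfNr opprK.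
  have [||||h1 h2] := ar (- y f) (- x g) (y g) => //; [apply/andP; split; lra| |lra].
  by move: xg => /andP[? ?]; apply/andP; split; lra.
(* The Daugavet equation for this operator provides [y], and a function norming [y + T y] provides
   [g]. *)
pose T (y : lipfree x0) := - y f *: x.
have Tlin : linear T.
  by move=> a y z; rewrite /T lfDl lfZl opprD -mulrN scalerDl scalerA.
pose T' : {linear lipfree x0 -> lipfree x0} :=
  HB.pack T (GRing.isLinear.Build _ _ _ _ T Tlin).
have Tb : bounded_op T'.
  exists 1 => y; rewrite /= /T normrZ x1 mulr1 normrN mul1r.
  by apply: (le_trans (lf_normr_le _ _)); rewrite -[leRHS]mulr1 ler_wpM2l.
have xf0 : x f != 0 by rewrite gt_eqF//; lra.
have Tr : rank_one T'.
  exists x; first by rewrite -normr_gt0 x1.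
  apply/seteqP; split => [_ [y _ <-]|_ [a _ <-]]; first by exists (- y f).
  exists ((- a / x f) *: x) => //=.
  by rewrite /T lfZl divfK// opprK.
have Tx : 1 - th <= opnorm T'.
  have := @opnorm_ub _ _ _ T' x Tb; rewrite x1 => /(_ (lexx _)).
  by rewrite /= /T normrZ normrN x1 mulr1; have := ler_norm (x f); lra.
have : 2 - 2 * th < opnorm (idfun \+ T') by rewrite (daug _ Tb Tr); lra.
move=> Ty; have [y y1 yT] : exists2 y : lipfree x0, `|y| <= 1 & 2 - 2 * th < `|y + T y|.
  apply: contrapT => H; move: Ty; apply/negP; rewrite -leNgt.
  apply: opnorm_le => y y1; rewrite leNgt; apply/negP => ?.
  by apply: H; exists y.
have [g g1 yTg] := lipfree_norming yT.
by exists y, g; split => //; move: yTg; rewrite lfDl lfZl mulNr.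
Qed.

End OppositeSlopes.

(** * Opposite slopes force approximate midpoints *)

Section MidpointsOfOppositeSlopes.
Context {R : realType} {M : metricType R}.
Implicit Types (a b : M -> R) (p q u v z : M).

Lemma nonexpansive_max a b : nonexpansive a -> nonexpansive b ->
  nonexpansive (fun z => Num.max (a z) (b z)).
Proof.
move=> al bl p q; rewrite lerBlDr ge_max; apply/andP; split.
  have : a q <= Num.max (a q) (b q) by rewrite le_max lexx.
  have := al p q; lra.
have : b q <= Num.max (a q) (b q) by rewrite le_max lexx orbT.
have := bl p q; lra.
Qed.

Lemma nonexpansive_min a b : nonexpansive a -> nonexpansive b ->
  nonexpansive (fun z => Num.min (a z) (b z)).
Proof.
move=> al bl p q; rewrite lerBlDl -lerBlDr le_min; apply/andP; split.
  have : Num.min (a p) (b p) <= a p by rewrite ge_min lexx.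
  have := al p q; lra.
have : Num.min (a p) (b p) <= b p by rewrite ge_min lexx orbT.
have := bl p q; lra.
Qed.

Lemma nonexpansive_dist p : nonexpansive (mdist p).
Proof. by move=> u v; rewrite lerBlDr addrC (metric_sym u) metric_triangle. Qed.

Definition tent (rho : R) p z : R := Num.max (rho - mdist p z) 0.

Lemma nonexpansive_tent rho p : nonexpansive (tent rho p).
Proof.
apply: nonexpansive_max => u v; last by rewrite subrr mdist_ge0.
have := nonexpansive_dist p v u; rewrite (metric_sym v u); lra.
Qed.

Lemma tent_ge0 rho p z : 0 <= tent rho p z.
Proof. by rewrite le_max lexx orbT. Qed.

Lemma tent_le rho p z : 0 <= rho -> tent rho p z <= rho.
Proof. by move=> r0; rewrite ge_max r0 lerBlDr lerDl mdist_ge0. Qed.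

Lemma tent0 rho p z : rho <= mdist p z -> tent rho p z = 0.
Proof. by move=> h; apply/max_idPr; lra. Qed.

Lemma tent_center rho p : 0 <= rho -> tent rho p p = rho.
Proof. by move=> h; rewrite /tent mdistxx subr0; apply/max_idPl. Qed.

Section TwoBalls.
Variables (p q : M) (rho eta : R).
Hypotheses (eta0 : 0 < eta) (rho0 : 0 < rho).
Hypothesis sep : forall z, rho + eta < mdist p z \/ rho + eta < mdist q z.

Let f z := tent rho p z - tent rho q z.

(** If [u] is outside the ball around [p], or [v] outside the one around [q], then a single
    nonexpansive tent accounts for the increment, which cannot exceed the distance. Separation puts
    each point outside the other, enlarged ball. *)
Lemma steep_in_balls u v : mdist u v < f u - f v ->
  [/\ mdist p u < rho, mdist q v < rho, rho + eta < mdist q u,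
      rho + eta < mdist p v & f u - f v <= 2 * rho].
Proof.
rewrite /f => uv; have e0 := eta0.
have Au := tent_ge0 rho p u; have Av := tent_ge0 rho p v.
have Bu := tent_ge0 rho q u; have Bv := tent_ge0 rho q v.
have Auv := nonexpansive_tent rho p u v.
have Bvu := nonexpansive_tent rho q v u; rewrite (metric_sym v u) in Bvu.
have [pu|pu] := leP rho (mdist p u).
  by have := tent0 pu; lra.
have [qv|qv] := leP rho (mdist q v).
  by have := tent0 qv; lra.
have A2 := tent_le p u (ltW rho0); have B2 := tent_le q v (ltW rho0).
split => //; last lra.
- by have [|] := sep u; lra.
- by have [|] := sep v; lra.
Qed.

(* Vanishes at [p'] and penalizes the other points of the ball around [p]. *)
Let h p p' z := Num.min (mdist p' z) (tent (rho + eta) p z).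

Let h_nonexp p1 p' : nonexpansive (h p1 p').
Proof.
apply: nonexpansive_min; [exact: nonexpansive_dist|exact: nonexpansive_tent].
Qed.

Let h_ge0 p1 p' z : 0 <= h p1 p' z.
Proof. by rewrite le_min mdist_ge0 tent_ge0. Qed.

Let h_out p1 p' z : rho + eta < mdist p1 z -> h p1 p' z = 0.
Proof. by move=> /ltW h1; rewrite /h (tent0 h1); apply/min_idPr; exact: mdist_ge0. Qed.

Let h_small p1 p' z (k : R) : mdist p1 z < rho -> k < eta -> h p1 p' z <= k ->
  mdist p' z <= k.
Proof.
move=> pz keta; rewrite ge_min => /orP[//|]; rewrite ge_max => /andP[? _]; lra.
Qed.

Variables (L : R) (p' q' : M) (th : R).
Hypotheses (L1 : 1 < L) (L2 : L <= 2) (fL : forall u v, f u - f v <= L * mdist u v).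
Hypotheses (th0 : 0 < th) (th1 : th <= (L - 1) / 40)
  (th2 : th <= (L - 1) / 4 * eta / (200 * rho)).
Hypotheses (pq' : p' != q') (steep_pq' : (1 - th) * L * mdist p' q' <= f p' - f q').

(** The penalties add at most [2 c] to a slope, and [1 + 2 c = (1 + L) / 2] is still below [L]. *)
Let c := (L - 1) / 4.
Let F z := f z - c * (h p p' z - h q q' z).

Let c0 : 0 < c. Proof. by rewrite divr_gt0// subr_gt0. Qed.

Let F_flat u v : f u - f v <= mdist u v -> F u - F v <= (1 + L) / 2 * mdist u v.
Proof.
move=> uv; have h1 := h_nonexp p p' v u; have h2 := h_nonexp q q' u v.
rewrite metric_sym in h1.
have : c * ((h p p' v - h p p' u) + (h q q' u - h q q' v)) <= c * (2 * mdist u v).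
  by rewrite ler_pM2l//; lra.
rewrite /F /c; lra.
Qed.

Let F_steep u v : mdist u v < f u - f v ->
  F u - F v = f u - f v - c * (h p p' u + h q q' v).
Proof.
move=> /steep_in_balls[_ _ qu pv _].
by rewrite /F (h_out _ qu) (h_out _ pv); ring.
Qed.

Let F_lip u v : F u - F v <= L * mdist u v.
Proof.
have [uv|uv] := leP (f u - f v) (mdist u v).
  apply: (le_trans (F_flat uv)); rewrite ler_wpM2r ?mdist_ge0//.
  by have := L1; lra.
rewrite F_steep//; apply: le_trans (fL u v).
by rewrite gerBl mulr_ge0 ?addr_ge0// ltW.
Qed.

Let thL : th * L <= (L - 1) / 20.
Proof. by have : th * L <= th * 2; [rewrite ler_pM2l|have := th1; lra]. Qed.

Let F_attained : (1 - th) * L * mdist p' q' <= F p' - F q'.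
Proof.
have d0 : 0 < mdist p' q' by rewrite mdist_gt0.
have pq1 : mdist p' q' < f p' - f q'.
  apply: lt_le_trans steep_pq'; rewrite -[ltLHS]mul1r ltr_pM2r//.
  by have := thL; have := L1; lra.
rewrite F_steep//.
have -> : h p p' p' = 0 by rewrite /h mdistxx; apply/min_idPl; exact: tent_ge0.
have -> : h q q' q' = 0 by rewrite /h mdistxx; apply/min_idPl; exact: tent_ge0.
by rewrite addr0 mulr0 subr0.
Qed.

(** A slope this close to [L] exceeds [(1 + L) / 2], so [f] itself has slope above 1 at the pair and
    only the penalties at [u] and [v] remain. They cost at most [9 th L d], for [d] the distance
    from [u] to [v], and [d <= 2 rho]; the bound on [th] makes this at most [c eta / 5]. *)
Let F_localized u v : u != v -> (1 - 9 * th) * L * mdist u v <= F u - F v ->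
  [/\ mdist p' u <= eta / 5, mdist q' v <= eta / 5 & eta <= mdist u v].
Proof.
have [e0 r0 l1 tl] := And4 eta0 rho0 L1 thL; have t0 := th0.
move=> uv FL; have d0 : 0 < mdist u v by rewrite mdist_gt0.
have uvf : mdist u v < f u - f v.
  rewrite ltNge; apply/negP => /F_flat uvF.
  have := le_trans FL uvF; rewrite ler_pM2r//; lra.
have [pu qv qu pv frho] := steep_in_balls uvf.
rewrite F_steep// in FL; have fuv := fL u v.
have drho : th * mdist u v <= th * (2 * rho) by rewrite ler_pM2l//; lra.
have thd : th * L * mdist u v <= 2 * (th * mdist u v).
  by rewrite -mulrA mulrCA ler_wpM2r// mulr_ge0// ltW.
have thr : th * (200 * rho) <= c * eta by rewrite -ler_pdivlMr// mulr_gt0.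
have ceta : 0 < c * eta by rewrite mulr_gt0.
have hs : c * (h p p' u + h q q' v) <= c * (eta / 5) by lra.
rewrite ler_pM2l// in hs.
have hu := h_ge0 p p' u; have hv := h_ge0 q q' v.
split.
- by apply: (h_small pu); lra.
- by apply: (h_small qv); lra.
have := metric_triangle p u v; lra.
Qed.

(** Both pairs found for [F / L] lie within [eta / 5] of [p'], [q']. The opposite increments of [g]
    add up to at least [11 / 10 * eta], whereas moving from one pair to the other costs at most
    [4 / 5 * eta]. *)
Lemma two_balls_contra : th <= 1 / 20 -> opposite_slopes M -> False.
Proof.
move=> th3 opp; have e0 := eta0; have l1 := L1.
have L0 : 0 < L by lra.
have FLE u v x : (x * mdist u v <= F u / L - F v / L) = (x * L * mdist u v <= F u - F v).
  by rewrite -mulrBl ler_pdivlMr// mulrAC.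
have [||g [u [v [u' [v' [g1 [uv s1] [_ s2] [uv' s3] [_ s4]]]]]]] :=
    opp (fun z => F z / L) th th0 th3.
- by move=> u v; rewrite -mulrBl ler_pdivrMr// mulrC.
- by exists p', q'; split => //; rewrite FLE.
rewrite FLE in s1; rewrite FLE in s3.
have [a1 a2 a3] := F_localized uv s1; have [b1 b2 b3] := F_localized uv' s3.
have := g1 u u'; have := g1 v' v.
have := metric_triangle u p' u'; have := metric_triangle v' q' v.
rewrite (metric_sym u p') (metric_sym v' q').
rewrite (metric_sym v' u') in s4.
have : (11 / 20) * mdist u v <= (1 - 9 * th) * mdist u v.
  by rewrite ler_wpM2r ?mdist_ge0//; lra.
have : (11 / 20) * mdist u' v' <= (1 - 9 * th) * mdist u' v'.
  by rewrite ler_wpM2r ?mdist_ge0//; lra.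
lra.
Qed.

End TwoBalls.

Theorem approx_midpoints_of_opposite_slopes :
  opposite_slopes M -> approx_midpoints M.
Proof.
move=> opp p q e e0; apply: contrapT => H.
(* Here [rho + eta = D / 2 + e] is the radius at which the balls are disjoint, while [2 rho > D]
   gives the difference of tents a slope above 1 at [p], [q]. *)
pose D := mdist p q; pose rho := D / 2 + e / 2; pose eta := e / 2.
have eta0 : 0 < eta by rewrite /eta; lra.
have sep z : rho + eta < mdist p z \/ rho + eta < mdist q z.
  have -> : rho + eta = D / 2 + e by rewrite /rho /eta; lra.
  have [pz|] := leP (mdist p z) (D / 2 + e); last by left.
  have [qz|] := leP (mdist q z) (D / 2 + e); last by right.
  by case: H; exists z; split => //; rewrite metric_sym.
have D2 : rho + eta < D.
  have D0 : 0 <= D := mdist_ge0 p q.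
  have [|] := sep p; first by rewrite mdistxx /rho /eta; lra.
  by rewrite metric_sym.
have rho0 : 0 < rho by have : 0 <= D := mdist_ge0 p q; rewrite /rho; lra.
pose f z := tent rho p z - tent rho q z.
have f2 u v : f u - f v <= 2 * mdist u v.
  have := nonexpansive_tent rho p u v.
  have := nonexpansive_tent rho q v u; rewrite (metric_sym v u) /f; lra.
have [f' f'2 f'E] := @lip0_of_fun _ _ p f 2 (ler0n _ _) f2.
have fE u v : f' u - f' v = f u - f v by rewrite !f'E; ring.
have [L LE] : exists L, L = `|f'| by eexists.
have fL u v : f u - f v <= L * mdist u v by rewrite -fE LE lip0_ler.
have L1 : 1 < L.
  have := fL p q; rewrite /f !tent_center ?(ltW rho0)//.
  have rD : rho <= mdist p q by rewrite -/D; lra.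
  have rD' : rho <= mdist q p by rewrite metric_sym.
  rewrite (tent0 rD) (tent0 rD').
  rewrite -/D subr0 sub0r opprK => LD; have D0 : 0 < D by lra.
  rewrite -(ltr_pM2r D0); apply: lt_le_trans LD; rewrite /rho; lra.
have L2 : L <= 2 by rewrite LE.
pose th := Num.min (1 / 20) (Num.min ((L - 1) / 40) ((L - 1) / 4 * eta / (200 * rho))).
have th0 : 0 < th.
  rewrite !lt_min; apply/and3P; split; [lra|lra|].
  by rewrite divr_gt0 ?mulr_gt0//; lra.
have th3 : [&& th <= 1 / 20, th <= (L - 1) / 40 & th <= (L - 1) / 4 * eta / (200 * rho)].
  by rewrite /th !ge_min !lexx !orbT.
have [{}th3 th1 th2] := and3P th3.
have [||p' [q' [pq' /ltW]]] := @lip0_steep _ _ _ f' ((1 - th) * L).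
- by rewrite mulr_ge0//; lra.
- by rewrite -LE gtr_pMl; lra.
rewrite fE => st.
exact: (two_balls_contra eta0 rho0 sep L1 L2 fL th0 th1 th2 pq' st th3 opp).
Qed.

End MidpointsOfOppositeSlopes.

Theorem mainTheorem2 (R : realType) (M : metricType R) (x0 : M)
    (hM : exists p q : M, p <> q) :
  locally_almost_square (lipfree x0) <-> Daugavet_property (lipfree x0).
Proof.
split=> [lasq|daug].
- apply/daugavet_of_approx_midpoints/approx_midpoints_of_opposite_slopes.
  exact: opposite_slopes_of_lasq lasq.
- apply/lasq_of_approx_midpoints/approx_midpoints_of_opposite_slopes.
  exact: opposite_slopes_of_daugavet daug.
Qed.
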